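(* Let $(\mathcal X,\rho)$ be a Polish space and $\mu\in P_2(\mathcal X)$. If $\mu$ satisfies $\mathbf{LSI}^+(C)$, then $\mu$ satisfies $\mathbf T_2(C)$.
   Context: $|\nabla^-f|(x)=\limsup_{y\to x}[f(y)-f(x)]_+/\rho(x,y)$ with $[a]_+=\max(a,0)$ (and $0$ at isolated points). $\mu$ satisfies $\mathbf{LSI}^+(C)$ if $\mathrm{Ent}_\mu(f^2)\le C\int|\nabla^-f|^2d\mu$ for all locally Lipschitz $f$, where $\mathrm{Ent}_\mu(g)=\int g\log g\,d\mu-\int g\,d\mu\log\int g\,d\mu$. $\mathcal T_2(\nu,\mu)=\inf_\pi\int\rho(x,y)^2d\pi$ over couplings; $H(\nu\,|\,\mu)=\int\log\frac{d\nu}{d\mu}d\nu$ if $\nu\ll\mu$, else $+\infty$; $\mathbf T_2(C)$ means $\mathcal T_2(\nu,\mu)\le C\,H(\nu\,|\,\mu)$ for all $\nu$. *)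

(* Defs.v *)
From HB Require Import structures.
From mathcomp Require Import all_boot all_order all_algebra.
From mathcomp Require Import all_classical all_reals all_analysis.
Set Implicit Arguments. Unset Strict Implicit. Unset Printing Implicit Defensive.
Import Order.TTheory GRing.Theory Num.Theory.
Local Open Scope classical_set_scope.
Local Open Scope ring_scope.

Section metric_defs.
Context {R : realType} {X : pointedType}.
Variable rho : X -> X -> R.

Definition is_metric : Prop :=
  [/\ forall x y, 0 <= rho x y,
      forall x y, rho x y = 0 <-> x = y,
      forall x y, rho x y = rho y x &
      forall x y z, rho x z <= rho x y + rho y z].

Definition rho_cauchy (u : nat -> X) : Prop :=
  forall e, 0 < e -> exists N, forall m n, (N <= m)%N -> (N <= n)%N ->
    rho (u m) (u n) < e.

Definition rho_complete : Prop :=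
  forall u : nat -> X, rho_cauchy u ->
    exists l, forall e, 0 < e -> exists N, forall n, (N <= n)%N -> rho (u n) l < e.

Definition rho_separable : Prop :=
  exists D : set X, countable D /\
    forall x e, 0 < e -> exists2 y, D y & rho x y < e.

Definition polish : Prop := [/\ is_metric, rho_complete & rho_separable].

Definition rho_open (A : set X) : Prop :=
  forall x, A x -> exists2 r, 0 < r & forall y, rho x y < r -> A y.

Definition loc_lipschitz (f : X -> R) : Prop :=
  forall x, exists2 r, 0 < r & exists L : R, forall y z,
    rho x y < r -> rho x z < r -> `|f y - f z| <= L * rho y z.

Definition isolated (x : X) : Prop :=
  exists2 r, 0 < r & forall y, ~ (0 < rho x y < r).

Definition slope_minus (f : X -> R) (x : X) : \bar R :=
  if pselect (isolated x) then 0%E else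
  ereal_inf [set ereal_sup
      [set ((Num.max (f y - f x) 0) / rho x y)%:E | y in [set y | 0 < rho x y < r]]
    | r in [set r : R | 0 < r]].

End metric_defs.

Notation borel rho := (g_sigma_algebraType (rho_open rho)).

Section measure_defs.
Context {R : realType} {X : pointedType}.
Variable rho : X -> X -> R.
Local Open Scope charge_scope.

Definition Ent (mu : probability (borel rho) R) (g : X -> R) : \bar R :=
  let I := fine (\int[mu]_x (g x)%:E)%E in
  (\int[mu]_x (g x * ln (g x))%R%:E - (I * ln I)%R%:E)%E.

Definition P2 (mu : probability (borel rho) R) : Prop :=
  exists x0 : X, (\int[mu]_x ((rho x0 x) ^+ 2)%R%:E < +oo)%E.

(** LSI^+(C); the inequality is required for locally Lipschitz f with
    int f^2 dmu < +oo (so that Ent_mu(f^2) is defined) *)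
Definition LSIplus (mu : probability (borel rho) R) (C : R) : Prop :=
  forall f : X -> R, loc_lipschitz rho f ->
    (\int[mu]_x ((f x) ^+ 2)%R%:E < +oo)%E ->
    (Ent mu (fun x => (f x ^+ 2)%R)
       <= C%:E * \int[mu]_x (slope_minus rho f x * slope_minus rho f x))%E.

Definition coupling (nu mu : probability (borel rho) R)
    (pi : probability (borel rho * borel rho)%type R) : Prop :=
  (forall A, measurable A -> pi (A `*` setT) = nu A) /\
  (forall B, measurable B -> pi (setT `*` B) = mu B).

Definition W2cost (nu mu : probability (borel rho) R) : \bar R :=
  ereal_inf [set (\int[pi]_p ((rho p.1 p.2) ^+ 2)%R%:E)%E
            | pi in [set pi | coupling nu mu pi]].

Definition relent (nu mu : probability (borel rho) R) : \bar R :=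
  if pselect (nu `<< mu) then
    (\int[nu]_x (ln (fine ('d (charge_of_finite_measure nu) '/d mu x)))%:E)%E
  else +oo%E.

Definition T2 (mu : probability (borel rho) R) (C : R) : Prop :=
  forall nu : probability (borel rho) R, (W2cost nu mu <= C%:E * relent nu mu)%E.

End measure_defs.

(* Main.v *)
(* For bounded [f >= 0] put [R_t x = inf_y (t f y + rho x y ^ 2)], which is
   concave in [t].  If [y] almost realises the infimum at [x], then the upward
   slope of [R_t] at [x] is at most [2 rho x y], while comparison with [R_s],
   [s > t], gives [rho x y ^ 2 <= R_t x - t (R_s x - R_t x) / (s - t)]; this is
   a Hamilton-Jacobi inequality in which no derivative occurs.  Inserted in
   LSI+ for [exp (R_t / (2 C))], it shows that
   [psi t = ln (int exp (R_t / C) dmu) / t] satisfies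
   [psi s <= psi t + K (s - t) ^ 2 / t], so [psi] is nonincreasing by summation
   along fine grids, and [psi 1 <= lim_(t -> 0) psi t <= int f dmu / C].  By the
   Gibbs variational inequality [int g dnu <= int f dmu + C H(nu | mu)] as soon
   as [g x <= f y + rho x y ^ 2].
   Such a dual bound yields couplings: quantise [mu] and [nu] on finitely many
   centres, with errors controlled by the second moments, solve the finite
   transport problem, and glue the conditional measures of the cells. *)

Require Import Defs.
From HB Require Import structures.
From mathcomp Require Import all_boot all_order all_algebra.
From mathcomp Require Import all_classical all_reals all_analysis.
From mathcomp Require Import measurable_realfun ring lra.
Import Order.TTheory GRing.Theory Num.Theory.
Import numFieldNormedType.Exports.
Set Implicit Arguments. Unset Strict Implicit. Unset Printing Implicit Defensive.
Local Open Scope classical_set_scope.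
Local Open Scope ring_scope.

(** * Infimal convolution with the squared distance *)

Section expR_bounds.
Context {R : realType}.
Implicit Types u v w : R.

Lemma expR_increment_le u v m : u <= m -> v <= m ->
  `|expR u - expR v| <= expR m * `|u - v|.
Proof.
wlog uv : u v / v <= u.
  move=> H um vm; case: (leP v u) => [|/ltW] vu; first exact: H.
  by rewrite distrC [`|u - v|]distrC; exact: H.
move=> um vm; rewrite !ger0_norm ?subr_ge0 ?ler_expR//.
have -> : expR v = expR u * expR (- (u - v)) by rewrite -expRD; congr expR; lra.
have h := expR_ge1Dx (- (u - v)).
have p := expR_gt0 u.
have pm : expR u <= expR m by rewrite ler_expR.
nra.
Qed.

(** This is [expR v - 1 <= v * expR v] used twice: once directly, once on the factor [expR v]. The
    explicit quadratic remainder takes the place of differentiating exponentials. *)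
Lemma expR_sub1_le v w : 0 <= v -> v <= w ->
  expR v - 1 <= v + v ^+ 2 * expR w.
Proof.
move=> v0 vw.
have h := expR_increment_le (lexx v) v0.
rewrite expR0 subr0 !ger0_norm ?subr_ge0 -?expR0 ?ler_expR// expR0 in h.
have : expR v <= expR w by rewrite ler_expR.
have := expR_gt0 v; nra.
Qed.

End expR_bounds.

Section infconv.
Context {R : realType} {X : pointedType} (rho : X -> X -> R).
Hypothesis rho_metric : is_metric rho.

Let rho_ge0 x y : 0 <= rho x y. Proof. by case: rho_metric. Qed.
Let rhoxx x : rho x x = 0. Proof. by case: rho_metric => _ + _ _; move=> /(_ x x)[_ ->]. Qed.
Let rhoC x y : rho x y = rho y x. Proof. by case: rho_metric. Qed.
Let rho_triangle x y z : rho x z <= rho x y + rho y z. Proof. by case: rho_metric. Qed.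

(** For [t > 0] this is [t] times the Hopf-Lax function [inf_y (f y + rho x y ^ 2 / t)]; with this
    scaling it is an infimum of affine functions of [t]. *)
Definition infconv (f : X -> R) (t : R) (x : X) : R :=
  inf [set t * f y + rho x y ^+ 2 | y in setT].

Context (f : X -> R) (M : R).
Hypothesis f_ge0 : forall y, 0 <= f y.
Hypothesis f_le : forall y, f y <= M.

Let M_ge0 : 0 <= M. Proof. exact: le_trans (f_ge0 point) (f_le point). Qed.

Lemma infconv_has_inf t x : 0 <= t ->
  has_inf [set t * f y + rho x y ^+ 2 | y in setT].
Proof.
move=> t0; split; first by exists (t * f x + rho x x ^+ 2), x.
by exists 0 => _ [y _ <-]; rewrite addr_ge0 ?mulr_ge0 ?sqr_ge0.
Qed.

Lemma infconv_le t x y : 0 <= t -> infconv f t x <= t * f y + rho x y ^+ 2.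
Proof.
move=> t0; apply: ge_inf; last by exists y.
by case: (infconv_has_inf x t0).
Qed.

Lemma infconv_approx t x e : 0 <= t -> 0 < e ->
  exists y, t * f y + rho x y ^+ 2 < infconv f t x + e.
Proof.
move=> t0 e0; have [_ [y _ <-] h] := inf_adherent e0 (infconv_has_inf x t0).
by exists y.
Qed.

Lemma le_infconv t x z : (forall y, z <= t * f y + rho x y ^+ 2) -> z <= infconv f t x.
Proof.
move=> h; apply: lb_le_inf; first by exists (t * f x + rho x x ^+ 2), x.
by move=> _ [y _ <-].
Qed.

Lemma infconv_ge0 t x : 0 <= t -> 0 <= infconv f t x.
Proof. by move=> t0; apply: le_infconv => y; rewrite addr_ge0 ?mulr_ge0 ?sqr_ge0. Qed.

Lemma infconv_le_self t x : 0 <= t -> infconv f t x <= t * f x.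
Proof. by move=> t0; have := infconv_le x x t0; rewrite rhoxx expr0n addr0. Qed.

Lemma infconv_le_bound t x : 0 <= t -> infconv f t x <= t * M.
Proof.
by move=> t0; apply: le_trans (infconv_le_self x t0) _; rewrite ler_wpM2l.
Qed.

Lemma infconv_nondecreasing t s x : 0 <= t -> t <= s ->
  infconv f t x <= infconv f s x.
Proof.
move=> t0 ts; apply: le_infconv => y; apply: le_trans (infconv_le x y t0) _.
by rewrite lerD2r ler_wpM2r.
Qed.

Lemma infconv_increment t s x : 0 <= t -> t <= s ->
  infconv f s x <= infconv f t x + (s - t) * M.
Proof.
move=> t0 ts; rewrite -lerBlDr; apply: le_infconv => y.
have := infconv_le x y (le_trans t0 ts); have := f_le y; have := f_ge0 y; nra.
Qed.

(** A minimiser [z] at [x] up to the error [rho x y] lies within [t * M + 1] of [x], so moving the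
    base point to [y] changes the squared distance to [z] by at most a multiple of [rho x y]. *)
Lemma infconv_local_lipschitz t x y : 0 <= t -> rho x y <= 1 ->
  `|infconv f t x - infconv f t y| <= (2 * t * M + 6) * rho x y.
Proof.
move=> t0.
wlog xy : x y / infconv f t x <= infconv f t y.
  move=> H d1; case: (leP (infconv f t x) (infconv f t y)) => [|/ltW] xy; first exact: H.
  by rewrite distrC rhoC; apply: H => //; rewrite rhoC.
move=> d1; rewrite ler0_norm ?subr_le0// opprB.
case: (eqVneq (rho x y) 0) => [d0|d0].
  case: rho_metric => _ /(_ x y)[/(_ d0) -> _] _ _.
  by rewrite subrr rhoxx mulr0.
have {d0} d0 : 0 < rho x y by rewrite lt_neqAle eq_sym d0 rho_ge0.
have [z zP] := infconv_approx x t0 d0.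
have h1 := infconv_le y z t0; have h2 := infconv_le_bound x t0.
have h3 := f_ge0 z; have h4 := rho_triangle y x z; rewrite (rhoC y x) in h4.
have h5 := rho_ge0 x z; have h6 := rho_ge0 y z; have h7 := M_ge0.
have h8 : 0 <= t * f z by rewrite mulr_ge0.
have h9 : rho x z <= t * M + 1.
  have : rho x z ^+ 2 <= t * M + 1 by lra.
  have : 0 <= t * M by rewrite mulr_ge0.
  nra.
nra.
Qed.

(* Approximate minimisers [y] of [t f y + rho x y ^ 2] satisfy
   [f y >= (infconv f s x - infconv f t x) / (s - t)] up to the error, so this
   quantity bounds [rho x y ^ 2]. *)
Definition infconv_gap t s x : R :=
  infconv f t x - t / (s - t) * (infconv f s x - infconv f t x).

Lemma infconv_gap_approx t s x e : 0 <= t -> t < s -> 0 < e ->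
  exists2 y, t * f y + rho x y ^+ 2 < infconv f t x + e &
             rho x y ^+ 2 <= infconv_gap t s x + e * (1 + t / (s - t)).
Proof.
move=> t0 ts e0; have [y yP] := infconv_approx x t0 e0; exists y => //.
have h1 := infconv_le x y (ltW (le_lt_trans t0 ts)).
have st : 0 < s - t by rewrite subr_gt0.
rewrite /infconv_gap; set k := t / (s - t).
have k0 : 0 <= k by rewrite divr_ge0// ltW.
have kE : k * (s - t) = t by rewrite /k divfK// gt_eqF.
(* Testing [y] in the infimum at [s] bounds [f y] from below; the factor [k] turns [(s - t) * f y]
   into [t * f y]. *)
have h2 : k * (infconv f s x - infconv f t x - e) <= k * ((s - t) * f y).
  by apply: ler_wpM2l => //; lra.
rewrite mulrA kE in h2; lra.
Qed.

(** The gap dominates a square up to an arbitrarily small error. Nonnegativity lets its square root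
    square back to it. *)
Lemma infconv_gap_ge0 t s x : 0 <= t -> t < s -> 0 <= infconv_gap t s x.
Proof.
move=> t0 ts; apply/ler_addgt0Pl => e e0.
have st : 0 < s - t by rewrite subr_gt0.
have k0 : 0 < 1 + t / (s - t) by rewrite ltr_pwDl// divr_ge0// ltW.
have [y _ h] := infconv_gap_approx x t0 ts (divr_gt0 e0 k0).
by rewrite divfK ?gt_eqF// in h; rewrite addrC (le_trans _ h)// sqr_ge0.
Qed.

Lemma infconv_upper_slope t s x : 0 <= t -> t < s ->
  exists2 K, 0 <= K & forall x', rho x x' <= 1 -> infconv f t x' - infconv f t x
     <= 2 * Num.sqrt (infconv_gap t s x) * rho x x' + K * rho x x' ^+ 2.
Proof.
move=> t0 ts; set A := Num.sqrt _.
have A0 : 0 <= A by rewrite sqrtr_ge0.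
have A2 : A ^+ 2 = infconv_gap t s x by rewrite sqr_sqrtr// infconv_gap_ge0.
have st : 0 < s - t by rewrite subr_gt0.
set k := 1 + t / (s - t).
have k1 : 1 <= k by rewrite lerDl divr_ge0// ltW.
exists (2 * k + 2); first lra.
move=> x' d1.
case: (eqVneq (rho x x') 0) => [d0|d0].
  case: rho_metric => _ /(_ x x')[/(_ d0) <- _] _ _.
  by rewrite subrr rhoxx mulr0 expr0n mulr0 addr0.
have {d0} d0 : 0 < rho x x' by rewrite lt_neqAle eq_sym d0 rho_ge0.
(* The tolerance [rho x x' ^ 2] makes the error of the minimiser second order, so it enters [K] and
   leaves the linear rate intact. *)
have [z z1 z2] := infconv_gap_approx x t0 ts (exprn_gt0 2 d0).
rewrite -A2 -/k in z2.
have z3 : rho x z <= A + rho x x' * k.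
  rewrite -(@ler_pXn2r _ 2) ?nnegrE ?addr_ge0 ?mulr_ge0//; last lra.
  have : rho x x' ^+ 2 * k <= rho x x' ^+ 2 * k ^+ 2.
    by rewrite ler_wpM2l ?sqr_ge0// expr2 ler_peMr//; lra.
  have : 0 <= A * (rho x x' * k) by rewrite !mulr_ge0//; lra.
  nra.
have h1 := infconv_le x' z t0.
have h4 := rho_triangle x' x z; rewrite (rhoC x' x) in h4.
have h5 := rho_ge0 x z; have h6 := rho_ge0 x' z.
have : rho x' z ^+ 2 <= (rho x x' + rho x z) ^+ 2 by rewrite ler_pXn2r ?nnegrE ?addr_ge0.
have : rho x x' * rho x z <= rho x x' * (A + rho x x' * k) by rewrite ler_pM2l.
rewrite sqrrD; nra.
Qed.

End infconv.

(** * From the log-Sobolev inequality to the Laplace transform *)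

Section probability_integrals.
Context d (T : measurableType d) (R : realType) (P : probability T R).
Implicit Types f g : T -> R.

Lemma EFin_Rintegral f : P.-integrable setT (EFin \o f) ->
  (\int[P]_x f x)%:E = (\int[P]_x (f x)%:E)%E.
Proof. by move=> /(integrable_fin_num measurableT) /fineK. Qed.

Lemma bounded_integrable f (B : R) : measurable_fun setT f ->
  (forall x, `|f x| <= B) -> P.-integrable setT (EFin \o f).
Proof.
move=> mf fB; apply: measurable_bounded_integrable => //.
  by apply: (le_lt_trans (probability_le1 P measurableT)); rewrite ltry.
exists B; split; first exact: num_real.
by move=> b Bb x _; apply: le_trans (fB x) (ltW Bb).
Qed.

Lemma integrable_addr f g : P.-integrable setT (EFin \o f) ->
  P.-integrable setT (EFin \o g) -> P.-integrable setT (EFin \o (fun x => f x + g x)).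
Proof. by move=> fi gi; exact: (integrableD measurableT fi gi). Qed.

Lemma integrable_scaler r f : P.-integrable setT (EFin \o f) ->
  P.-integrable setT (EFin \o (fun x => r * f x)).
Proof. by move=> fi; exact: (integrableZl measurableT r fi). Qed.

Lemma integrable_cstr r : P.-integrable setT (EFin \o (fun=> r)).
Proof. by apply: (@bounded_integrable _ `|r|). Qed.

Lemma Rintegral_lincomb a b f g : P.-integrable setT (EFin \o f) ->
  P.-integrable setT (EFin \o g) ->
  \int[P]_x (a * f x + b * g x) = a * \int[P]_x f x + b * \int[P]_x g x.
Proof.
move=> fi gi; rewrite RintegralD//; try exact: integrable_scaler.
by rewrite !RintegralZl.
Qed.

Lemma Rintegral_probability_cst (r : R) : \int[P]_x r = r.
Proof.
rewrite Rintegral_cst// -[RHS]mulr1; congr (_ * _).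
have h := congr1 fine (probability_setT P); exact: h.
Qed.

(* Unlike [ge0_le_integral], this needs no measurability of the slope. *)
Lemma ge0_le_integralT (f g : T -> \bar R) : (forall x, 0 <= f x)%E ->
  (forall x, f x <= g x)%E -> (\int[P]_x f x <= \int[P]_x g x)%E.
Proof.
move=> f0 fg; rewrite !ge0_integralTE//; last by move=> x; apply: le_trans (fg x).
by apply: le_ereal_sup => _ [h hf <-]; exists h => // x; apply: le_trans (fg x).
Qed.

End probability_integrals.

(** * Slopes and Borel measurability on a metric space *)

Section slopes.
Context {R : realType} {X : pointedType} (rho : X -> X -> R).
Hypothesis rho_metric : is_metric rho.

Let rho_ge0 x y : 0 <= rho x y. Proof. by case: rho_metric. Qed.
Let rhoC x y : rho x y = rho y x. Proof. by case: rho_metric. Qed.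
Let rho_triangle x y z : rho x z <= rho x y + rho y z. Proof. by case: rho_metric. Qed.

Lemma continuous_borel_measurable (g : X -> R) :
  (forall x e, 0 < e -> exists2 r, 0 < r & forall y, rho x y < r -> `|g x - g y| < e) ->
  measurable_fun setT (g : borel rho -> R).
Proof.
move=> gc; apply: (measurability _ (RGenOInfty.measurableE R)) => _ [_ [b ->] <-].
rewrite setTI; apply: sub_sigma_algebra => x /=; rewrite in_itv/= andbT => bx.
have [r r0 rP] := gc x (g x - b) ltac:(by rewrite subr_gt0).
exists r => // y /rP; rewrite /= in_itv/= andbT ltr_norml => /andP[_]; lra.
Qed.

Lemma dist_borel_measurable x0 : measurable_fun setT (rho x0 : borel rho -> R).
Proof.
apply: continuous_borel_measurable => x e e0; exists e => // y xy.
have := rho_triangle x0 x y; have := rho_triangle x0 y x; rewrite (rhoC y x) => *.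
by rewrite ltr_norml; apply/andP; split; lra.
Qed.

Lemma slope_minus_ge0 (f : X -> R) x : (0 <= slope_minus rho f x)%E.
Proof.
rewrite /slope_minus; case: pselect => // nix.
apply/ereal_infP => _ [r r0 <-].
(* A point in the punctured ball keeps the supremum away from [-oo], its value on the empty set. *)
have [y yr] : exists y, 0 < rho x y < r.
  by apply: contrapT => H; apply: nix; exists r => // y yr; apply: H; exists y.
apply: le_trans (_ : ((Num.max (f y - f x) 0) / rho x y)%:E <= _)%E.
  by rewrite lee_fin divr_ge0// le_max lexx orbT.
by apply: ereal_sup_ubound; exists y.
Qed.

Lemma slope_minus_le (f : X -> R) x (B K : R) : 0 <= B -> 0 <= K ->
  (forall y, rho x y <= 1 -> f y - f x <= B * rho x y + K * rho x y ^+ 2) ->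
  (slope_minus rho f x <= B%:E)%E.
Proof.
move=> B0 K0 fB; rewrite /slope_minus; case: pselect => [iso|nix]; first by rewrite lee_fin.
(* On this ball the quadratic term is at most [e * rho x y]; [K + 1] avoids a division by zero. *)
apply/lee_addgt0Pr => e e0; set r := Num.min 1 (e / (K + 1)).
have K1 : 0 < K + 1 by lra.
have r0 : 0 < r by rewrite lt_min ltr01 divr_gt0.
apply: le_trans (ereal_inf_lbound _) _; first by exists r.
apply/ereal_supP => _ [y /andP[d0 dr] <-].
rewrite -EFinD lee_fin ler_pdivrMr//.
have [d1 de] : rho x y < 1 /\ rho x y < e / (K + 1).
  by move: dr; rewrite /r lt_min => /andP[].
rewrite ltr_pdivlMr// in de.
have h := fB y (ltW d1).
rewrite ge_max; apply/andP; split; last by rewrite mulr_ge0//; lra.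
apply: le_trans h _; nra.
Qed.

End slopes.

(** * The log-Sobolev inequality applied to exponentials of infimal convolutions *)

Section entropy_step.
Context {R : realType} {X : pointedType} (rho : X -> X -> R).
Hypothesis rho_metric : is_metric rho.
Context (mu : probability (borel rho) R) (C : R).
Hypotheses (C_gt0 : 0 < C) (mu_LSI : LSIplus mu C).
Context (f : X -> R) (M : R).
Hypothesis f_ge0 : forall y, 0 <= f y.
Hypothesis f_le : forall y, f y <= M.

Local Notation Q := (infconv rho f).

Let M_ge0 : 0 <= M. Proof. exact: le_trans (f_ge0 point) (f_le point). Qed.

Lemma infconv_measurable t : 0 <= t -> measurable_fun setT (Q t : borel rho -> R).
Proof.
move=> t0; apply: continuous_borel_measurable => x e e0.
pose L := 2 * t * M + 6.
have L0 : 0 < L by rewrite ltr_wpDl// !mulr_ge0.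
exists (Num.min 1 (e / L)); first by rewrite lt_min ltr01 divr_gt0.
move=> y; rewrite lt_min => /andP[d1]; rewrite ltr_pdivlMr// mulrC.
by apply: le_lt_trans; apply: infconv_local_lipschitz => //; exact: ltW.
Qed.

Definition laplace t : R := \int[mu]_x expR (Q t x / C).

Lemma expR_infconv_integrable t : 0 <= t ->
  mu.-integrable setT (EFin \o (fun x => expR (Q t x / C))).
Proof.
move=> t0; apply: (@bounded_integrable _ _ _ _ _ (expR (t * M / C))).
  apply: measurableT_comp => //; apply: measurable_funM => //.
  exact: infconv_measurable.
move=> x; rewrite ger0_norm ?expR_ge0// ler_expR ler_pM2r ?invr_gt0//.
exact: infconv_le_bound.
Qed.

Let QexpQ_integrable t s : 0 <= t -> 0 <= s ->
  mu.-integrable setT (EFin \o (fun x => Q s x / C * expR (Q t x / C))).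
Proof.
move=> t0 s0; apply: (@bounded_integrable _ _ _ _ _ (s * M / C * expR (t * M / C))).
  apply: measurable_funM.
    by apply: measurable_funM => //; exact: infconv_measurable.
  apply: measurableT_comp => //; apply: measurable_funM => //.
  exact: infconv_measurable.
have q u x : 0 <= u -> 0 <= Q u x / C <= u * M / C.
  move=> u0; rewrite divr_ge0 ?infconv_ge0// ?(ltW C_gt0)//=.
  by rewrite ler_pM2r ?invr_gt0//; exact: infconv_le_bound.
move=> x; have /andP[a0 a1] := q s x s0; have /andP[b0 b1] := q t x t0.
rewrite normrM (ger0_norm a0) (ger0_norm (expR_ge0 _)).
by rewrite ler_pM ?expR_ge0 ?ler_expR.
Qed.

Let F t x := expR (Q t x / (2 * C)).

Let F_sqr t x : F t x ^+ 2 = expR (Q t x / C).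
Proof. by rewrite expr2 -expRD; congr expR; field; rewrite gt_eqF. Qed.

Let F_loc_lipschitz t : 0 <= t -> loc_lipschitz rho (F t).
Proof.
move=> t0 x; exists 2^-1; first by rewrite invr_gt0.
exists (expR (t * M / (2 * C)) * ((2 * t * M + 6) / (2 * C))) => y z xy xz.
have C2 : 0 < 2 * C by rewrite mulr_gt0.
have yz : rho y z <= 1.
  case: rho_metric => _ _ rhoC rhoD; have := rhoD y x z; rewrite (rhoC y x); lra.
apply: le_trans (expR_increment_le (m := t * M / (2 * C)) _ _) _.
- by rewrite ler_pM2r ?invr_gt0//; exact: infconv_le_bound.
- by rewrite ler_pM2r ?invr_gt0//; exact: infconv_le_bound.
rewrite -[leRHS]mulrA ler_pM2l ?expR_gt0// -mulrBl normrM.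
rewrite [`|(2 * C)^-1|]ger0_norm ?invr_ge0 ?(ltW C2)//.
rewrite mulrAC ler_pM2r ?invr_gt0//.
exact: infconv_local_lipschitz.
Qed.

(** Factoring out [F t x] leaves the exponential of an increment whose linear rate is
    [2 * sqrt(gap) / (2 * C)]. The rest of the increment and the remainder of the exponential are
    quadratic in the distance. *)
Let F_slope t s x : 0 <= t -> t < s ->
  (slope_minus rho (F t) x <= (F t x * (Num.sqrt (infconv_gap rho f t s x) / C))%:E)%E.
Proof.
move=> t0 ts; set A := Num.sqrt _.
have A0 : 0 <= A / C by rewrite divr_ge0 ?sqrtr_ge0// ltW.
have [K K0 KP] := infconv_upper_slope rho_metric f_ge0 x t0 ts; rewrite -/A in KP.
have C2 : 0 < 2 * C by rewrite mulr_gt0.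
have F0 : 0 < F t x by rewrite expR_gt0.
pose k := K / (2 * C).
have k0 : 0 <= k by rewrite divr_ge0// ltW.
pose V := A / C + k.
have V0 : 0 <= V by rewrite addr_ge0.
apply: (slope_minus_le rho_metric (K := F t x * (k + V ^+ 2 * expR V))).
- by rewrite mulr_ge0// ltW.
- by rewrite mulr_ge0 ?addr_ge0// ?mulr_ge0 ?sqr_ge0 ?expR_ge0// ltW.
move=> y d1; have d0 : 0 <= rho x y by case: rho_metric.
set d := rho x y in d0 d1 *.
pose v := A / C * d + k * d ^+ 2.
have v0 : 0 <= v by rewrite addr_ge0// mulr_ge0// sqr_ge0.
have vV : v <= V * d.
  rewrite /v /V mulrDl lerD2l ler_wpM2l// expr2 ler_piMl//.
have vV1 : v <= V by apply: le_trans vV _; rewrite ler_piMr.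
have e1 : F t y = F t x * expR ((Q t y - Q t x) / (2 * C)).
  by rewrite -expRD; congr expR; field; rewrite gt_eqF.
have e2 : expR ((Q t y - Q t x) / (2 * C)) <= expR v.
  rewrite ler_expR ler_pdivrMr//; apply: le_trans (KP y d1) _; rewrite -/d.
  rewrite le_eqVlt; apply/orP; left; apply/eqP; rewrite /v /k; field; rewrite gt_eqF//.
have e3 := expR_sub1_le v0 vV1.
have e4 : v ^+ 2 <= V ^+ 2 * d ^+ 2.
  by rewrite -exprMn ler_pXn2r ?nnegrE ?mulr_ge0.
have e5 : v ^+ 2 * expR V <= V ^+ 2 * d ^+ 2 * expR V by rewrite ler_wpM2r ?expR_ge0.
rewrite e1 -[X in _ - X]mulr1 -mulrBr -!mulrA -mulrDr ler_pM2l//.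
apply: le_trans (_ : expR v - 1 <= _); first by rewrite lerD2r.
by apply: le_trans e3 _; rewrite {1}/v; lra.
Qed.

(** This is a difference form of [t * phi' <= phi * ln phi] for [phi = laplace]: the left side
    stands for [(s - t) * phi' t]. *)
Lemma entropy_step t s : 0 < t -> t < s ->
  \int[mu]_x ((Q s x - Q t x) / C * expR (Q t x / C))
    <= (s - t) / t * (laplace t * ln (laplace t)).
Proof.
move=> t0 ts; have t0' := ltW t0; have s0 := ltW (lt_trans t0 ts).
have C0 := ltW C_gt0; have Cn : C != 0 by rewrite gt_eqF.
have iF : (\int[mu]_x (F t x ^+ 2)%:E)%E = (laplace t)%:E.
  rewrite /laplace EFin_Rintegral; last exact: expR_infconv_integrable.
  by apply: eq_integral => x _; rewrite F_sqr.
have := @mu_LSI (F t) (F_loc_lipschitz t0').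
rewrite iF ltry => /(_ isT); rewrite /Ent iF /=.
have -> : (\int[mu]_x (F t x ^+ 2 * ln (F t x ^+ 2))%:E)%E =
    (\int[mu]_x (Q t x / C * expR (Q t x / C)))%:E.
  rewrite EFin_Rintegral; last exact: QexpQ_integrable.
  by apply: eq_integral => x _; rewrite F_sqr expRK mulrC.
set E1 := \int[mu]_x (Q t x / C * expR (Q t x / C)).
pose E2 := \int[mu]_x (Q s x / C * expR (Q t x / C)).
have i1 := QexpQ_integrable t0' t0'; have i2 := QexpQ_integrable t0' s0.
have k0 : 0 < t / (s - t) by rewrite divr_gt0// subr_gt0.
set k := t / (s - t) in k0 *.
(* The gap is [(1 + k) * Q t x - k * Q s x], so the energy side becomes a combination of [E1] and
   [E2]; one [E1] then cancels against the entropy side. *)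
move=> H; have {H} : E1 - laplace t * ln (laplace t) <= (1 + k) * E1 + - k * E2.
  rewrite -lee_fin EFinB; apply: le_trans H _.
  rewrite -Rintegral_lincomb//; set h := (fun x => _ + _).
  have hi : mu.-integrable setT (EFin \o h).
    by apply: integrable_addr; exact: integrable_scaler.
  have -> : \int[mu]_x h x = C * \int[mu]_x (C^-1 * h x).
    by rewrite RintegralZl// mulVKf.
  rewrite EFinM EFin_Rintegral; last exact: integrable_scaler.
  apply: lee_wpmul2l; first by rewrite lee_fin.
  apply: ge0_le_integralT => x.
    by rewrite mule_ge0// slope_minus_ge0.
  have S0 := slope_minus_ge0 rho_metric (F t) x.
  have SB := F_slope x t0' ts.
  apply: le_trans (lee_pmul S0 S0 SB SB) _.
  rewrite -EFinM lee_fin le_eqVlt; apply/orP; left; apply/eqP.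
  set A := Num.sqrt _.
  have A2 : A ^+ 2 = infconv_gap rho f t s x.
    by rewrite sqr_sqrtr// (infconv_gap_ge0 rho_metric f_ge0).
  rewrite -expr2 exprMn F_sqr exprMn A2 /h /infconv_gap -/k; by field.
move=> H; apply: (@le_trans _ _ (E2 - E1)).
  rewrite -RintegralB// le_eqVlt; apply/orP; left; apply/eqP.
  by apply: eq_Rintegral => x _; rewrite !mulrBl.
have st : 0 < s - t by rewrite subr_gt0.
rewrite -ler_pdivrMl ?divr_gt0// invf_div -/k; lra.
Qed.
End entropy_step.

Lemma ln_le_subr1 (R : realType) (y : R) : 0 < y -> ln y <= y - 1.
Proof. by move=> y0; have := expR_ge1Dx (ln y); rewrite lnK ?posrE//; lra. Qed.

Lemma ln_le_add (R : realType) (a b z : R) : 0 < a -> 0 < b -> b <= a * (1 + z) ->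
  ln b <= ln a + z.
Proof.
move=> a0 b0 ba; have ea : expR (ln a) = a by rewrite lnK.
have eb : expR (ln b) = b by rewrite lnK.
rewrite -ler_expR expRD ea eb; apply: le_trans ba _.
by rewrite ler_pM2l// expR_ge1Dx.
Qed.

(** * Monotonicity of the normalised log-Laplace transform and its limit at zero *)

Section log_laplace.
Context {R : realType} {X : pointedType} (rho : X -> X -> R).
Hypothesis rho_metric : is_metric rho.
Context (mu : probability (borel rho) R) (C : R).
Hypotheses (C_gt0 : 0 < C) (mu_LSI : LSIplus mu C).
Context (f : X -> R) (M : R).
Hypothesis f_ge0 : forall y, 0 <= f y.
Hypothesis f_le : forall y, f y <= M.

Local Notation Q := (infconv rho f).
Local Notation phi := (laplace mu C f).

Let M_ge0 : 0 <= M. Proof. exact: le_trans (f_ge0 point) (f_le point). Qed.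

(** [V] bounds the growth of [Q t x / C] per unit of [t]; [K] bounds the quadratic remainder of its
    exponential, uniformly over time steps of length at most one. *)
Let V := M / C.
Let K := V ^+ 2 * expR V.

Let V_ge0 : 0 <= V. Proof. by rewrite divr_ge0// ltW. Qed.
Let K_ge0 : 0 <= K. Proof. by rewrite mulr_ge0 ?sqr_ge0 ?expR_ge0. Qed.

Let expR_le w h : 0 <= h <= 1 -> 0 <= w <= h * V ->
  expR w <= 1 + w + K * h ^+ 2.
Proof.
move=> /andP[h0 h1] /andP[w0 wh].
have wV : w <= V by apply: le_trans wh _; rewrite ler_piMl.
have := expR_sub1_le w0 wV.
have : w ^+ 2 * expR V <= (h * V) ^+ 2 * expR V.
  by rewrite ler_wpM2r ?expR_ge0// ler_pXn2r ?nnegrE// mulr_ge0.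
rewrite /K exprMn; lra.
Qed.

Let expQ_integrable t (t0 : 0 <= t) :=
  expR_infconv_integrable rho_metric mu C_gt0 f_ge0 f_le t0.

Lemma laplace_ge1 t : 0 <= t -> 1 <= phi t.
Proof.
move=> t0; rewrite -[leLHS](Rintegral_probability_cst mu).
apply: le_Rintegral => //; [exact: integrable_cstr|exact: expQ_integrable|].
move=> x _; rewrite -expR0 ler_expR divr_ge0 ?infconv_ge0//; exact: ltW.
Qed.

Let psi t := ln (phi t) / t.

(** The exponential of the increment of [Q / C] is expanded to first order, and [entropy_step]
    bounds the first-order term. Logarithms give [ln (phi s) <= s / t * ln (phi t) + K * (s - t) ^
    2], which is then divided by [s]. *)
Let psi_step t s : 0 < t -> t < s -> s <= 1 ->
  psi s <= psi t + K * (s - t) ^+ 2 / t.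
Proof.
move=> t0 ts s1; have t0' := ltW t0; have s0 := lt_trans t0 ts.
have p1 := laplace_ge1 t0'; have q1 := laplace_ge1 (ltW s0).
have st : 0 < s - t by rewrite subr_gt0.
have l0 : 0 <= ln (phi t) by rewrite ln_ge0.
have step := entropy_step rho_metric C_gt0 mu_LSI f_ge0 f_le t0 ts.
set I := (X in X <= _) in step.
have bound : phi s <= phi t + (I + K * (s - t) ^+ 2 * phi t).
  pose w x := (Q s x - Q t x) / C.
  have wP x : 0 <= w x <= (s - t) * V.
    rewrite /w divr_ge0 ?(ltW C_gt0) ?subr_ge0 ?infconv_nondecreasing ?(ltW ts)//=.
    rewrite /V mulrA ler_pM2r ?invr_gt0// lerBlDl.
    by apply: infconv_increment => //; exact: ltW.
  have iw : mu.-integrable setT (EFin \o (fun x => w x * expR (Q t x / C))).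
    apply: (@bounded_integrable _ _ _ _ _ ((s - t) * V * expR (t * M / C))).
      apply: measurable_funM.
        by apply: measurable_funM => //; apply: measurable_funB;
          apply: infconv_measurable f_le _ _ => //; exact: ltW.
      apply: measurableT_comp => //; apply: measurable_funM => //.
      exact: infconv_measurable f_le _ _.
    move=> x; have /andP[w0 w1] := wP x.
    rewrite normrM (ger0_norm w0) (ger0_norm (expR_ge0 _)).
    rewrite ler_pM ?expR_ge0 ?ler_expR ?ler_pM2r ?invr_gt0//.
    exact: infconv_le_bound.
  have ie := expQ_integrable t0'.
  apply: (@le_trans _ _ (\int[mu]_x (1 * (w x * expR (Q t x / C))
      + (1 + K * (s - t) ^+ 2) * expR (Q t x / C)))).
    apply: le_Rintegral => //; first exact/expQ_integrable/ltW.
      by apply: integrable_addr; exact: integrable_scaler.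
    move=> x _; have -> : Q s x / C = Q t x / C + w x by rewrite /w mulrBl addrC subrK.
    rewrite expRD; have h := expR_le (_ : 0 <= s - t <= 1) (wP x).
    rewrite mul1r -mulrDl mulrC ler_wpM2r ?expR_ge0//.
    by rewrite addrCA addrA; apply: h; rewrite (ltW st) lerBlDr (le_trans s1)// lerDl.
  by rewrite Rintegral_lincomb// mul1r [in leLHS]mulrDl mul1r addrCA.
have phi_le : phi s <= phi t * (1 + ((s - t) / t * ln (phi t) + K * (s - t) ^+ 2)).
  apply: le_trans bound _; rewrite mulrDr mulr1 lerD2l mulrDr; apply: lerD.
    by rewrite mulrCA.
  by rewrite mulrC.
have := ln_le_add (lt_le_trans ltr01 p1) (lt_le_trans ltr01 q1) phi_le.
have -> : ln (phi t) + ((s - t) / t * ln (phi t) + K * (s - t) ^+ 2)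
   = s / t * ln (phi t) + K * (s - t) ^+ 2 by field; rewrite gt_eqF.
move=> H; rewrite /psi ler_pdivrMr// mulrDl; apply: le_trans H _; apply: lerD.
  by rewrite le_eqVlt; apply/orP; left; apply/eqP; field; rewrite gt_eqF.
rewrite -[leLHS]mulr1 -[leRHS]mulrA ler_wpM2l//.
  by rewrite mulr_ge0 ?sqr_ge0.
by rewrite ler_pdivlMl// mulr1 ltW.
Qed.

(** Each step is shorter than [1 / n.+1] and starts at or after [t0], which bounds its error in
    [psi_step] uniformly. *)
Let psi_grid t0 (n k : nat) : 0 < t0 -> t0 < 1 -> (k <= n.+1)%N ->
  psi (t0 + k%:R * ((1 - t0) / n.+1%:R)) <= psi t0 + k%:R * (K / t0 / n.+1%:R ^+ 2).
Proof.
move=> t00 t01; elim: k => [|k IH] kn; first by rewrite !mul0r !addr0.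
set h := (1 - t0) / n.+1%:R.
have n0 : 0 < n.+1%:R :> R by rewrite ltr0n.
have h0 : 0 < h by rewrite divr_gt0// subr_gt0.
have tk : t0 <= t0 + k%:R * h by rewrite lerDl mulr_ge0// ltW.
have step : t0 + k.+1%:R * h - (t0 + k%:R * h) = h.
  by rewrite -natr1; lra.
apply: le_trans (@psi_step (t0 + k%:R * h) _ _ _ _) _.
- exact: lt_le_trans tk.
- by rewrite -subr_gt0 step.
- have : k.+1%:R * h <= n.+1%:R * h by rewrite ler_wpM2r ?(ltW h0)// ler_nat.
  rewrite [X in _ <= X -> _]mulrC divfK ?gt_eqF//; lra.
rewrite step -natr1 mulrDl mul1r addrA; apply: lerD; first exact/IH/ltnW.
apply: (@le_trans _ _ (K * h ^+ 2 / t0)).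
  rewrite ler_wpM2l ?(mulr_ge0 K_ge0 (sqr_ge0 _))// lef_pV2 ?posrE//.
  exact: lt_le_trans tk.
rewrite mulrAC ler_wpM2l ?(divr_ge0 K_ge0 (ltW t00))//.
rewrite /h expr_div_n ler_piMl ?invr_ge0 ?sqr_ge0//.
rewrite expr_le1//; lra.
Qed.

Let psi_nonincreasing t0 : 0 < t0 -> t0 < 1 -> psi 1 <= psi t0.
Proof.
move=> t00 t01; apply/ler_addgt0Pr => e e0.
have Kt : 0 <= K / t0 by rewrite divr_ge0// ltW.
(* Over the whole grid the errors add up to [K / t0 / n.+1], which this [n] brings below [e]. *)
pose n := Num.truncn (K / t0 / e).
have nP : K / t0 / e < n.+1%:R by apply: truncnS_gt.
have := @psi_grid t0 n n.+1 t00 t01 (leqnn _).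
have n0 : 0 < n.+1%:R :> R by rewrite ltr0n.
have n0' : n.+1%:R != 0 :> R by rewrite gt_eqF.
have -> : t0 + n.+1%:R * ((1 - t0) / n.+1%:R) = 1 by field.
have -> : n.+1%:R * (K / t0 / n.+1%:R ^+ 2) = K / t0 / n.+1%:R.
  by rewrite expr2 invfM mulrCA mulVKf.
move=> H; apply: le_trans H _; rewrite lerD2l ler_pdivrMr//.
by rewrite -ler_pdivrMl// mulrC ltW.
Qed.

(** By monotonicity [psi 1 <= psi t] for small [t]. From [Q t x <= t * f x] the value [phi t] is at
    most [1 + t * int f / C + K * t ^ 2], so [psi t] exceeds [int f / C] by at most [K * t]. *)
Lemma ln_laplace_le : measurable_fun setT (f : borel rho -> R) ->
  ln (phi 1) <= \int[mu]_x f x / C.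
Proof.
move=> mf; apply/ler_addgt0Pr => e e0.
pose t := Num.min 2^-1 (e / (K + 1)).
have K1 : 0 < K + 1 by rewrite ltr_wpDl.
have t0 : 0 < t by rewrite lt_min invr_gt0 ltr0n divr_gt0.
have t1 : t < 1 by rewrite gt_min invf_lt1 ?ltr1n.
have tK : K * t <= e.
  have : t <= e / (K + 1) by rewrite ge_min lexx orbT.
  rewrite ler_pdivlMr// => h; apply: le_trans h.
  by rewrite mulrC ler_wpM2l ?(ltW t0)// lerDl.
have := @psi_nonincreasing t t0 t1.
have psi1 : psi 1 = ln (phi 1) by exact: divr1.
rewrite psi1 => H; apply: le_trans H _.
rewrite (ler_pdivrMr _ _ t0).
have fi : mu.-integrable setT (EFin \o (f : borel rho -> R)).
  apply: (@bounded_integrable _ _ _ _ _ M) => // x; rewrite ger0_norm//.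
apply: le_trans (ln_le_subr1 _) _.
  exact: lt_le_trans ltr01 (laplace_ge1 (ltW t0)).
rewrite lerBlDl.
apply: (@le_trans _ _ (\int[mu]_x (1 * (1 + K * t ^+ 2) + t / C * f x))).
  apply: le_Rintegral => //; first exact/expQ_integrable/ltW.
    by apply: integrable_addr; apply: integrable_scaler => //; exact: integrable_cstr.
  move=> x _; have q1 : Q t x / C <= t / C * f x.
    rewrite mulrAC ler_pM2r ?invr_gt0//; apply: infconv_le_self => //; exact: ltW.
  have : expR (Q t x / C) <= expR (t / C * f x) by rewrite ler_expR.
  move=> H; apply: le_trans H _; rewrite mul1r addrAC; apply: expR_le.
    by rewrite (ltW t0) (ltW t1).
  rewrite mulr_ge0 ?divr_ge0 ?(ltW t0) ?(ltW C_gt0)//=.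
  by rewrite -mulrA ler_pM2l// /V mulrC ler_pM2r ?invr_gt0.
rewrite Rintegral_lincomb//; last exact: integrable_cstr.
rewrite Rintegral_probability_cst mul1r -addrA lerD2l [leRHS]mulrDl.
have := ler_wpM2r (ltW t0) tK; rewrite expr2 mulrA.
have -> : t / C * \int[mu]_x f x = \int[mu]_x f x / C * t by field; rewrite gt_eqF.
lra.
Qed.

End log_laplace.

(** * Gibbs variational inequality and the dual transport bound *)

Lemma integrable_ae_eq d (T : measurableType d) (R : realType)
    (mu : {measure set T -> \bar R}) (f g : T -> \bar R) :
  measurable_fun setT g -> ae_eq mu setT f g ->
  mu.-integrable setT f -> mu.-integrable setT g.
Proof.
move=> mg fg /integrableP[mf fi]; apply/integrableP; split=> //.
rewrite (ae_eq_integral (abse \o f))//.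
- exact: measurableT_comp.
- exact: measurableT_comp.
- by apply: filterS fg => x /= H Dx; rewrite H.
Qed.

Section gibbs.
Context d (T : measurableType d) (R : realType) (mu nu : probability T R).
Hypothesis nu_mu : nu `<< mu.
Local Open Scope charge_scope.

(** [h] is the density occurring in [relent]; [k] is a version of it that is nonnegative and finite
    everywhere and comes with the change of variables formula. *)
Let h x := fine (('d (charge_of_finite_measure nu) '/d mu) x).
Let k x := fine (Radon_Nikodym_SigmaFinite.f nu mu x).

Let mh : measurable_fun setT h.
Proof. by apply: measurableT_comp => //; exact: measurable_int (Radon_Nikodym_integrable nu_mu). Qed.

Let mk : measurable_fun setT k.
Proof.
apply: measurableT_comp => //.
exact: measurable_int (Radon_Nikodym_SigmaFinite.f_integrable nu_mu).
Qed.

Let ln_hk : ae_eq nu setT (EFin \o (fun x => ln (h x))) (EFin \o (fun x => ln (k x))).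
Proof.
have := ae_eq_Radon_Nikodym_SigmaFinite nu_mu measurableT.
move=> /(null_dominates_ae_eq measurableT nu_mu) H.
by apply: filterS H => x Hx _ /=; rewrite /h /k Hx.
Qed.

Let change (psi : T -> R) : measurable_fun setT psi -> (forall x, 0 <= psi x) ->
  (\int[nu]_x (psi x)%:E = \int[mu]_x (psi x * k x)%:E)%E.
Proof.
move=> mpsi psi0.
rewrite -(@Radon_Nikodym_SigmaFinite.change_of_variables _ _ _ nu mu nu_mu (EFin \o psi))//.
  by apply: eq_integral => x _; rewrite EFinM fineK// Radon_Nikodym_SigmaFinite.f_fin_num.
exact/measurable_EFinP.
Qed.

(* The junk value [ln 0 = 0] makes [expR (ln 0) = 1], so that the change of
   measure needs no exceptional set where the density vanishes. *)
Let expR_sub_ln_le (u : T -> R) : measurable_fun setT u ->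
  (\int[nu]_x (expR (u x - ln (k x)))%:E <= \int[mu]_x (expR (u x))%:E)%E.
Proof.
move=> mu_; rewrite change; last by move=> x; exact: expR_ge0.
  apply: ge0_le_integralT => x; rewrite lee_fin ?mulr_ge0 ?expR_ge0 ?fine_ge0//.
    exact: Radon_Nikodym_SigmaFinite.f_ge0.
  rewrite expRD -mulrA -[leRHS]mulr1 ler_pM2l ?expR_gt0//.
  rewrite expRN ler_pdivrMl ?expR_gt0// mulr1.
  have [k0|k0] := leP (k x) 0; first exact: le_trans k0 (expR_ge0 _).
  by rewrite lnK.
apply: measurableT_comp => //; apply: measurable_funB => //.
by apply: measurableT_comp => //.
Qed.

(** The negative part of the log-density always has a finite integral: it is at most
    [expR (- ln (k x))], whose [nu]-integral is at most the [mu]-mass one. An integral below [+oo]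
    then controls the positive part as well. *)
Lemma relent_integrable :
  (\int[nu]_x (ln (fine (('d (charge_of_finite_measure nu) '/d mu) x)))%:E < +oo)%E ->
  nu.-integrable setT
    (EFin \o (fun x => ln (fine (('d (charge_of_finite_measure nu) '/d mu) x)))).
Proof.
have mlk : measurable_fun setT (fun x => ln (k x)) by apply: measurableT_comp.
have mlh : measurable_fun setT (fun x => ln (h x)) by apply: measurableT_comp.
rewrite (ae_eq_integral (EFin \o (fun x => ln (k x))))//; last 2 first.
- exact/measurable_EFinP.
- exact/measurable_EFinP.
set g := EFin \o _ => gfin.
have mg : measurable_fun setT g by exact/measurable_EFinP.
have gneg : (\int[nu]_x g^\- x < +oo)%E.
  have c0 : measurable_fun [set: T] (cst (0 : R)) by [].
  apply: le_lt_trans (_ : _ <= \int[nu]_x (expR (0 - ln (k x)))%:E)%E _.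
    apply: ge0_le_integralT => // x; rewrite funenegE /g /= -EFin_max lee_fin.
    rewrite ge_max expR_ge0 andbT sub0r; have := expR_ge1Dx (- ln (k x)); lra.
  apply: le_lt_trans (@expR_sub_ln_le (cst 0) c0) _; under eq_integral do rewrite /= expR0.
  by rewrite integral_cst// mul1e; apply: (le_lt_trans (probability_le1 mu measurableT)); rewrite ltry.
have gpos : (\int[nu]_x g^\+ x < +oo)%E.
  move: gfin; rewrite integralE; set a := (\int[nu]_x g^\+ x)%E.
  have : (0 <= \int[nu]_x g^\- x)%E by exact: integral_ge0.
  move: gneg; case: (\int[nu]_x g^\- x)%E => [b|//|//] _ _.
  by rewrite !ltey; case: a.
have gi : nu.-integrable setT g.
  rewrite (funeposneg g); apply: integrableB => //.
    apply/integrableP; split; first exact: measurable_funepos.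
    by under eq_integral do rewrite gee0_abs//.
  apply/integrableP; split; first exact: measurable_funeneg.
  by under eq_integral do rewrite gee0_abs//.
apply: (@integrable_ae_eq _ _ _ _ g) => //.
  exact/measurable_EFinP.
exact: ae_eq_sym.
Qed.

(** Integrating [1 + z <= expR z] at [z = u x - ln (k x)] against [nu] gives a right side of at most
    [int expR u dmu], hence at most one, and the two ones cancel. *)
Lemma gibbs_variational (u : T -> R) :
  nu.-integrable setT (EFin \o (fun x => ln (fine (('d (charge_of_finite_measure nu) '/d mu) x)))) ->
  nu.-integrable setT (EFin \o u) ->
  (\int[mu]_x (expR (u x))%:E <= 1)%E ->
  \int[nu]_x u x <=
  \int[nu]_x ln (fine (('d (charge_of_finite_measure nu) '/d mu) x)).
Proof.
move=> hi ui u1.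
have mlk : measurable_fun setT (fun x => ln (k x)) by apply: measurableT_comp.
have mlh : measurable_fun setT (fun x => ln (h x)) by apply: measurableT_comp.
have ki : nu.-integrable setT (EFin \o (fun x => ln (k x))).
  by apply: integrable_ae_eq ln_hk hi; exact/measurable_EFinP.
have -> : \int[nu]_x ln (fine (('d (charge_of_finite_measure nu) '/d mu) x)) =
    \int[nu]_x ln (k x).
  congr fine; apply: ae_eq_integral => //; exact/measurable_EFinP.
have mu_ : measurable_fun setT u by exact/measurable_EFinP/(measurable_int _ ui).
have le1 := le_trans (expR_sub_ln_le mu_) u1.
have ei : nu.-integrable setT (EFin \o (fun x => expR (u x - ln (k x)))).
  apply/integrableP; split.
    apply/measurable_EFinP; apply: measurableT_comp => //; exact: measurable_funB.
  apply: le_lt_trans (le_trans _ le1) (ltry 1).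
  apply: ge0_le_integralT => // x; by rewrite gee0_abs// lee_fin expR_ge0.
have e1 : \int[nu]_x expR (u x - ln (k x)) <= 1 by rewrite -lee_fin EFin_Rintegral.
have : \int[nu]_x (1 * u x + 1 * (1 + (-1) * ln (k x))) <= \int[nu]_x expR (u x - ln (k x)).
  apply: le_Rintegral => //.
    by apply: integrable_addr; apply: integrable_scaler => //;
      apply: integrable_addr; [exact: integrable_cstr|exact: integrable_scaler].
  by move=> x _; have := expR_ge1Dx (u x - ln (k x)); lra.
rewrite Rintegral_lincomb//; last first.
  by apply: integrable_addr; [exact: integrable_cstr|exact: integrable_scaler].
rewrite RintegralD//; [|exact: integrable_cstr|exact: integrable_scaler].
rewrite RintegralZl// Rintegral_probability_cst; move: (\int[nu]_x _) => I.
move: (\int[nu]_x _) (\int[nu]_x _) e1 => A B.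
lra.
Qed.

End gibbs.

Lemma half_sqr_le (R : realType) (a b c : R) : 0 <= a -> 0 <= b -> 0 <= c ->
  a <= b + c -> 2^-1 * a ^+ 2 <= b ^+ 2 + c ^+ 2.
Proof.
move=> a0 b0 c0 abc; have : a ^+ 2 <= (b + c) ^+ 2 by rewrite ler_pXn2r ?nnegrE ?addr_ge0.
by have := sqr_ge0 (b - c); rewrite sqrrB sqrrD; lra.
Qed.

(** * Kantorovich dual form of the transport inequality and its consequence for second moments *)

Section dual.
Context {R : realType} {X : pointedType} (rho : X -> X -> R).
Hypothesis rho_metric : is_metric rho.
Context (mu nu : probability (borel rho) R) (C : R).
Hypotheses (C_gt0 : 0 < C) (mu_LSI : LSIplus mu C) (nu_mu : nu `<< mu).
Local Open Scope charge_scope.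

Let lnh x := ln (fine (('d (charge_of_finite_measure nu) '/d mu) x)).
Hypothesis lnh_integrable : nu.-integrable setT (EFin \o lnh).

Let rhoC x y : rho x y = rho y x. Proof. by case: rho_metric. Qed.
Let rho_ge0 x y : 0 <= rho x y. Proof. by case: rho_metric. Qed.
Let rho_triangle x y z : rho x z <= rho x y + rho y z. Proof. by case: rho_metric. Qed.

(** The shift [F = f + B] gives a nonnegative bounded function; [g + B] lies below its infimal
    convolution at time one, and [B] cancels at the end. *)
Lemma transport_dual (f g : X -> R) (B : R) :
  measurable_fun setT (f : borel rho -> R) -> (forall y, `|f y| <= B) ->
  nu.-integrable setT (EFin \o (g : borel rho -> R)) ->
  (forall x y, g x <= f y + rho x y ^+ 2) ->
  \int[nu]_x g x <= \int[mu]_x f x + C * \int[nu]_x lnh x.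
Proof.
move=> mf fB gi gf.
pose F y := f y + B.
have F0 y : 0 <= F y by have := fB y; rewrite ler_norml /F => /andP[]; lra.
have FB y : F y <= 2 * B by have := fB y; rewrite ler_norml /F => /andP[]; lra.
have mF : measurable_fun setT (F : borel rho -> R) by exact: measurable_funD.
pose Q := infconv rho F 1; pose phi := laplace mu C F 1.
have Cn : C != 0 by rewrite gt_eqF.
have phi1 : 1 <= phi by apply: laplace_ge1 F0 FB _ _.
have phi0 : 0 < phi by exact: lt_le_trans phi1.
have iQ : nu.-integrable setT (EFin \o (Q : borel rho -> R)).
  apply: (@bounded_integrable _ _ _ _ _ (1 * (2 * B))).
    exact: infconv_measurable FB _ _.
  move=> x; rewrite ger0_norm; first exact: infconv_le_bound.
  exact: infconv_ge0.
(* Subtracting [ln phi] normalises [expR u] to integral one under [mu]. *)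
pose u (x : borel rho) := C^-1 * Q x + 1 * - ln phi.
have iu : nu.-integrable setT (EFin \o u).
  by apply: integrable_addr; apply: integrable_scaler => //; exact: integrable_cstr.
have ie := expR_infconv_integrable rho_metric mu C_gt0 F0 FB ler01.
have u1 : (\int[mu]_x (expR (u x))%:E <= 1)%E.
  rewrite (eq_integral (fun x : borel rho => (phi^-1 * expR (Q x / C))%:E)); last first.
    move=> x _; rewrite /u expRD mul1r expRN lnK// mulrC; congr (_ * expR _)%:E.
    by rewrite mulrC.
  rewrite -EFin_Rintegral; last exact: integrable_scaler.
  by rewrite RintegralZl// -[X in _ * X]/phi mulVf// gt_eqF.
have := gibbs_variational nu_mu lnh_integrable iu u1.
rewrite Rintegral_lincomb//; last exact: integrable_cstr.
rewrite Rintegral_probability_cst mul1r -[X in _ <= X]/(\int[nu]_x lnh x).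
have := ln_laplace_le rho_metric C_gt0 mu_LSI F0 FB mF; rewrite -/phi.
have -> : \int[mu]_x F x = \int[mu]_x f x + B.
  rewrite RintegralD//; last exact: integrable_cstr.
    by rewrite Rintegral_probability_cst.
  exact: (@bounded_integrable _ _ _ mu _ B).
have : \int[nu]_x (1 * g x + 1 * B) <= \int[nu]_x Q x.
  apply: le_Rintegral => //.
    by apply: integrable_addr; apply: integrable_scaler => //; exact: integrable_cstr.
  move=> x _; apply: le_infconv => y; have := gf x y; rewrite /F; lra.
rewrite Rintegral_lincomb//; last exact: integrable_cstr.
rewrite Rintegral_probability_cst !mul1r.
move: (\int[nu]_x _) (\int[nu]_x _) (\int[nu]_x _) (\int[mu]_x _) (ln phi) => c b a e l.
move=> h1 h2 h3.
have h4 : C * (C^-1 * b - l) <= C * c by rewrite ler_pM2l.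
have h5 : C * l <= C * ((e + B) / C) by rewrite ler_pM2l.
rewrite mulrBr mulVKf// in h4; rewrite [X in _ <= X]mulrC divfK// in h5; lra.
Qed.

Lemma relent_ge0 : 0 <= \int[nu]_x lnh x.
Proof.
have := @transport_dual (cst 0) (cst 0) 0 _ _ _ _.
rewrite !Rintegral_probability_cst add0r pmulr_rge0//; apply => //.
- by move=> y; rewrite normr0.
- exact: integrable_cstr.
- by move=> x y; rewrite add0r sqr_ge0.
Qed.

(** The dual bound is tested on the truncation of [rho x0 x ^ 2] at [n] and on half of it; the half
    pays for the squared triangle inequality. The bound does not depend on [n], so monotone
    convergence concludes. *)
Lemma second_moment_dominated (x0 : X) :
  (\int[mu]_x ((rho x0 x) ^+ 2)%:E < +oo)%E ->
  (\int[nu]_x ((rho x0 x) ^+ 2)%:E < +oo)%E.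
Proof.
move=> mu2.
pose a (x : borel rho) := rho x0 x ^+ 2.
have ma : measurable_fun setT a.
  by apply: measurable_funX; exact: dist_borel_measurable.
have a0 x : 0 <= a x by rewrite sqr_ge0.
have ia : mu.-integrable setT (EFin \o a).
  apply/integrableP; split; first exact/measurable_EFinP.
  by under eq_integral do rewrite /= ger0_norm//.
pose g n (x : borel rho) := Num.min (a x) n%:R.
have mg n : measurable_fun setT (g n) by exact: measurable_minr.
have g0 n x : 0 <= g n x by rewrite le_min a0/=.
have gB n x : `|g n x| <= n%:R by rewrite ger0_norm// ge_min lexx orbT.
have gn n : nu.-integrable setT (EFin \o g n) by exact: bounded_integrable (gB n).
pose b := 2 * (\int[mu]_x a x + C * \int[nu]_x lnh x).
have bound n : (\int[nu]_x (g n x)%:E <= b%:E)%E.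
  rewrite -EFin_Rintegral// lee_fin /b -ler_pdivrMl//.
  have gn2 := integrable_scaler 2^-1 (gn n).
  have gg x y : 2^-1 * g n x <= g n y + rho x y ^+ 2.
    rewrite /g; case: (leP (a y) n%:R) => an.
      apply: (@le_trans _ _ (2^-1 * a x)); first by rewrite ler_pM2l ?ge_min ?lexx.
      have tri := rho_triangle x0 y x; rewrite (rhoC y x) in tri.
      exact: half_sqr_le (rho_ge0 x0 x) (rho_ge0 x0 y) (rho_ge0 x y) tri.
    have h1 : Num.min (a x) n%:R <= n%:R by rewrite ge_min lexx orbT.
    have h2 : 0 <= Num.min (a x) n%:R := g0 n x.
    have := sqr_ge0 (rho x y); move: (rho x y ^+ 2) (Num.min _ _) h1 h2 => p q h1 h2 p0.
    rewrite (le_trans (_ : _ <= q))//; last by rewrite (le_trans h1)// lerDl.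
    by rewrite ler_piMl// invf_le1 ?ler1n.
  have := transport_dual (mg n) (gB n) gn2 gg; rewrite RintegralZl// => H.
  apply: le_trans H _; rewrite lerD2r; apply: le_Rintegral => //.
    exact: (@bounded_integrable _ _ _ mu _ n%:R).
  by move=> x _; rewrite ge_min lexx.
have g_homo m n x : (m <= n)%N -> g m x <= g n x.
  move=> mn; rewrite /g le_min !ge_min lexx/=; apply/orP; right.
  by rewrite ler_nat.
have glim x : limn (fun n => (g n x)%:E) = (a x)%:E.
  apply/cvg_lim => //; apply: cvg_near_cst; near=> n.
  rewrite /g min_l//; near: n; exact: nbhs_infty_ger.
under eq_integral do rewrite -/(a _) -glim.
rewrite monotone_convergence//.
- apply: le_lt_trans (ltry b); apply: lime_le; last exact: nearW.
  apply: ereal_nondecreasing_is_cvgn => m n mn.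
  by apply: ge0_le_integralT => x; rewrite lee_fin// g_homo.
- by move=> n; exact/measurable_EFinP.
- by move=> n x _; rewrite lee_fin.
- by move=> x _ m n mn; rewrite lee_fin g_homo.
Unshelve. all: by end_near.
Qed.

End dual.

(** * Finite transport duality *)

Lemma box_argmin (R : realType) (T : finType) (M : R)
    (F : prod_topology (fun _ : T => R) -> R) :
  0 <= M -> continuous F ->
  exists2 x : T -> R, (forall t, 0 <= x t <= M) &
    forall y : T -> R, (forall t, 0 <= y t <= M) -> F x <= F y.
Proof.
move=> M0 cF.
pose A := [set f : prod_topology (fun _ : T => R) | forall t, `[0, M]%classic (f t)].
have cA : @compact (prod_topology (fun _ : T => R)) A.
  apply (@tychonoff T (fun=> R) (fun=> `[0, M]%classic)) => t.
  exact: (@segment_compact R 0 M).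
have A0 : A !=set0 by exists (fun=> 0) => t /=; rewrite in_itv/= lexx M0.
have [x xA xmin] := compact_EVT_min A0 cA (continuous_subspaceT cF).
exists x; first by move=> t; move: xA => /[!inE]/(_ t); rewrite /= in_itv.
by move=> y yA; apply: xmin; rewrite inE => t /=; rewrite in_itv/=.
Qed.

(** Division by [s] and [s -> 0]: the one-sided first-order condition at a minimiser on a box. *)
Lemma linear_coef_ge0 (R : realFieldType) (a k s0 : R) : 0 < s0 ->
  (forall s, 0 <= s <= s0 -> 0 <= s * a + k * s ^+ 2) -> 0 <= a.
Proof.
move=> s00 H; apply/ler_addgt0Pr => e e0.
pose K := `|k| + 1.
have K0 : 0 < K by rewrite ltr_wpDl.
pose s := Num.min s0 (e / K).
have sgt0 : 0 < s by rewrite lt_min s00 divr_gt0.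
have s1 : s * K <= e by rewrite -ler_pdivlMr// ge_min lexx orbT.
have := H s; rewrite (ltW sgt0) ge_min lexx => /(_ isT).
rewrite expr2 mulrCA -mulrDr pmulr_rge0// => h.
have : k * s <= K * s by rewrite ler_pM2r// (le_trans (ler_norm _))// lerDl.
lra.
Qed.

Section finite_transport.
Context {R : realType} {I J : finType} (p : I -> R) (q : J -> R) (c : I -> J -> R).
Hypothesis p_ge0 : forall i, 0 <= p i.
Hypothesis c_ge0 : forall i j, 0 <= c i j.

Implicit Types x : I * J -> R.
Let row x i := \sum_j x (i, j).
Let col x j := \sum_i x (i, j).
Let cost x := \sum_i \sum_j x (i, j) * c i j.
Let defect x := \sum_i (row x i - p i) ^+ 2 + \sum_j (col x j - q j) ^+ 2.

Let bump x i j s : I * J -> R := fun t => x t + s * ((t.1 == i) && (t.2 == j))%:R.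

Let sum_indic (T : finType) (t : T) (u : T -> R) : \sum_t' u t' * (t' == t)%:R = u t.
Proof.
rewrite (bigD1 t)//= eqxx mulr1 big1 ?addr0// => t' /negbTE ->.
by rewrite mulr0.
Qed.

Let row_bump x i j s i' : row (bump x i j s) i' = row x i' + s * (i' == i)%:R.
Proof.
rewrite /row /bump big_split /=; congr (_ + _).
by rewrite -(sum_indic j (fun=> s * (i' == i)%:R)); apply: eq_bigr => j' _;
  rewrite -mulrA -natrM mulnb.
Qed.

Let col_bump x i j s j' : col (bump x i j s) j' = col x j' + s * (j' == j)%:R.
Proof.
rewrite /col /bump big_split /=; congr (_ + _).
by rewrite -(sum_indic i (fun=> s * (j' == j)%:R)); apply: eq_bigr => i' _;
  rewrite -mulrA -natrM mulnb andbC.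
Qed.

Let cost_bump x i j s : cost (bump x i j s) = cost x + s * c i j.
Proof.
rewrite /cost /bump.
under eq_bigr => i' _ do (under eq_bigr do rewrite mulrDl; rewrite big_split /=).
rewrite big_split /=; congr (_ + _).
rewrite -[RHS](sum_indic i (fun i' => s * c i' j)); apply: eq_bigr => i' _.
rewrite -[RHS](sum_indic j (fun j' => s * c i' j' * (i' == i)%:R)); apply: eq_bigr => j' _.
by rewrite -mulnb natrM; ring.
Qed.

Let sqr_bump (T : finType) (u : T -> R) (t : T) (s : R) :
  \sum_t' (u t' + s * (t' == t)%:R) ^+ 2 = \sum_t' u t' ^+ 2 + (2 * s * u t + s ^+ 2).
Proof.
under eq_bigr => t' _.
  have -> : (u t' + s * (t' == t)%:R) ^+ 2 =
      u t' ^+ 2 + (2 * s * u t' + s ^+ 2) * (t' == t)%:R by case: eqP => _ /=; ring.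
  over.
by rewrite big_split/= (sum_indic t (fun t' => 2 * s * u t' + s ^+ 2)).
Qed.

Let defect_bump x i j s : defect (bump x i j s) =
  defect x + 2 * (s * (row x i - p i) + s * (col x j - q j) + s ^+ 2).
Proof.
rewrite /defect.
under eq_bigr do rewrite row_bump addrAC.
under [X in _ + X]eq_bigr do rewrite col_bump addrAC.
rewrite (sqr_bump (fun i => row x i - p i)) (sqr_bump (fun j => col x j - q j)); ring.
Qed.

Let W := prod_topology (fun _ : I * J => R).

Let proj_cont t : continuous (fun x : W => x t).
Proof. exact: (@proj_continuous _ (fun _ : I * J => R) t). Qed.

Let sum_cont (U : topologicalType) (T : finType) (f : T -> U -> R) :
  (forall t, continuous (f t)) -> continuous (fun z => \sum_t f t z).
Proof.
move=> cf; apply: continuous_big => //; exact: add_continuous.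
Qed.

Let mul_cont (U : topologicalType) (f g : U -> R) :
  continuous f -> continuous g -> continuous (fun z => f z * g z).
Proof. by move=> cf cg z; exact: (continuousM (cf z) (cg z)). Qed.

Let add_cont (U : topologicalType) (f g : U -> R) :
  continuous f -> continuous g -> continuous (fun z => f z + g z).
Proof. by move=> cf cg z; exact: (continuousD (cf z) (cg z)). Qed.

Let cst_cont (U : topologicalType) (r : R) : continuous (fun _ : U => r).
Proof. exact: cst_continuous. Qed.

Let cost_cont : continuous (cost : W -> R).
Proof.
apply: sum_cont => i; apply: sum_cont => j.
by apply: mul_cont; [exact: proj_cont|exact: cst_cont].
Qed.

Let defect_cont : continuous (defect : W -> R).
Proof.
have sq (u : W -> R) r : continuous u ->
    continuous (fun z => (u z - r) ^+ 2).
  by move=> cu; apply: (@mul_cont W) => //; apply: (@add_cont W) => //; exact: cst_cont.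
by apply: add_cont; apply: sum_cont => t; apply: sq; apply: sum_cont => t'; exact: proj_cont.
Qed.

Let defect_ge0 x : 0 <= defect x.
Proof. by rewrite addr_ge0// sumr_ge0// => *; exact: sqr_ge0. Qed.

Let cost_ge0 x : (forall t, 0 <= x t) -> 0 <= cost x.
Proof. by move=> x0; rewrite sumr_ge0// => i _; rewrite sumr_ge0// => j _; rewrite mulr_ge0. Qed.

Let D0 := defect (fun=> 0).
Let M := 1 + D0 + \sum_i p i.

Let M_ge1 : 1 <= M.
Proof. by rewrite /M -addrA lerDl addr_ge0 ?defect_ge0 ?sumr_ge0. Qed.

(** An entry of size [M] would make its row exceed [p i] by at least [1 + D0], and the square of
    this is more than [D0]. Hence the upper wall of the box never blocks a variation. *)
Let small_defect x i j : (forall t, 0 <= x t) -> defect x <= D0 -> x (i, j) < M.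
Proof.
move=> x0 xD; rewrite ltNge; apply/negP => Mx.
have pi : p i <= \sum_i p i by rewrite (bigD1 i)//= lerDl sumr_ge0.
have xr : x (i, j) <= row x i by rewrite /row (bigD1 j)//= lerDl sumr_ge0.
have D00 : 0 <= D0 by exact: defect_ge0.
have : (row x i - p i) ^+ 2 <= defect x.
  rewrite /defect (bigD1 i)//= -addrA lerDl addr_ge0// sumr_ge0// => *; exact: sqr_ge0.
have : 1 + D0 <= row x i - p i by move: Mx; rewrite /M; lra.
nra.
Qed.

(* Minimising the transport cost plus a quadratic penalty on the marginals: the
   first-order conditions say that [k * defects of the marginals] is, up to
   sign, a feasible dual pair satisfying complementary slackness. *)
Let penalised (V k : R) :
  (forall g f, (forall i j, g i <= f j + c i j) ->
     \sum_i p i * g i - \sum_j q j * f j <= V) ->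
  0 < k -> exists2 x, (forall t, 0 <= x t <= M) & cost x <= V /\ k * defect x <= V.
Proof.
move=> dualV k0.
have k2 : 0 < k / 2 by rewrite divr_gt0.
pose F x := cost x + k / 2 * defect x.
have cF : continuous (F : W -> R).
  apply: add_cont; first exact: cost_cont.
  by apply: mul_cont; [exact: cst_cont|exact: defect_cont].
have [x xM xmin] := box_argmin (le_trans ler01 M_ge1) cF.
have x0 t : 0 <= x t by case/andP: (xM t).
(* Comparison with the zero plan, whose transport cost is zero. *)
have xD : defect x <= D0.
  have := xmin (fun=> 0) _; rewrite lexx (le_trans ler01 M_ge1) => /(_ (fun=> isT)).
  rewrite /F [X in _ <= X + _ -> _]/cost big1 ?add0r; last first.
    by move=> i _; rewrite big1// => j _; rewrite mul0r.
  move=> h; rewrite -(ler_pM2l k2); apply: le_trans h.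
  by rewrite lerDr cost_ge0.
pose a i := k * (row x i - p i); pose b j := k * (col x j - q j).
have F_bump i j s : F (bump x i j s) - F x = s * (c i j + a i + b j) + k * s ^+ 2.
  by rewrite /F cost_bump defect_bump /a /b; field.
have bumpM i j s : 0 <= x (i, j) + s <= M -> forall t, 0 <= bump x i j s t <= M.
  move=> h [i' j']; rewrite /bump/=.
  case: (eqVneq i' i) => [->|_]; last by rewrite mulr0 addr0.
  by case: (eqVneq j' j) => [->|_]; rewrite /= ?mulr1// mulr0 addr0.
(* Every entry is below [M] and may be increased, which gives dual feasibility of [- a] and [b]. *)
have feas i j : 0 <= c i j + a i + b j.
  have xl := small_defect i j x0 xD.
  apply: (@linear_coef_ge0 _ _ k (M - x (i, j))); first by rewrite subr_gt0.
  move=> s /andP[s0 s1]; rewrite -F_bump subr_ge0; apply: xmin; apply: bumpM.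
  by rewrite addr_ge0//= -lerBrDl.
(* A positive entry may also be decreased, which forces equality there. *)
have slack i j : x (i, j) * (c i j + a i + b j) = 0.
  case: (eqVneq (x (i, j)) 0) => [->|xn]; first by rewrite mul0r.
  have xp : 0 < x (i, j) by rewrite lt_neqAle eq_sym xn x0.
  apply/eqP; rewrite mulf_eq0 (negbTE xn)/= eq_le feas andbT -oppr_ge0.
  apply: (@linear_coef_ge0 _ _ k (x (i, j))) => // s /andP[s0 s1].
  have := F_bump i j (- s); rewrite sqrrN mulNr -mulrN => <-; rewrite subr_ge0.
  apply: xmin; apply: bumpM; rewrite subr_ge0 s1/=.
  by have /andP[_] := xM (i, j); apply: le_trans; rewrite gerDl oppr_le0.
(* The slackness identities are summed. Since [a] and [b] are [k] times the marginal errors,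
   [cost x + k * defect x] becomes exactly the dual value of [- a] and [b]. *)
have costE : cost x = - \sum_i row x i * a i - \sum_j col x j * b j.
  have : \sum_i \sum_j x (i, j) * (c i j + a i + b j) = 0.
    by rewrite big1// => i _; rewrite big1.
  under eq_bigr => i _ do (under eq_bigr do rewrite !mulrDr; rewrite !big_split /=).
  rewrite !big_split/= => h; apply/eqP; rewrite -subr_eq0; apply/eqP; rewrite -[RHS]h.
  rewrite -/(cost x).
  have -> : \sum_i row x i * a i = \sum_i \sum_j x (i, j) * a i.
    by apply: eq_bigr => i _; rewrite mulr_suml.
  have -> : \sum_j col x j * b j = \sum_i \sum_j x (i, j) * b j.
    by rewrite exchange_big; apply: eq_bigr => j _; rewrite mulr_suml.
  by rewrite !opprD !opprK addrA.
have dual := dualV (fun i => - a i) b.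
have {}dual : \sum_i p i * - a i - \sum_j q j * b j <= V.
  by apply: dual => i j; have := feas i j; lra.
have rowE : \sum_i row x i * a i = \sum_i p i * a i + k * \sum_i (row x i - p i) ^+ 2.
  rewrite mulr_sumr -big_split/=; apply: eq_bigr => i _; rewrite /a; ring.
have colE : \sum_j col x j * b j = \sum_j q j * b j + k * \sum_j (col x j - q j) ^+ 2.
  rewrite mulr_sumr -big_split/=; apply: eq_bigr => j _; rewrite /b; ring.
have key : cost x + k * defect x <= V.
  apply: le_trans dual; rewrite costE rowE colE /defect.
  under [X in _ <= X - _]eq_bigr do rewrite mulrN.
  rewrite sumrN; lra.
exists x => //; split; apply: le_trans key.
  by rewrite lerDl mulr_ge0// ltW.
by rewrite lerDr cost_ge0.
Qed.

Lemma finite_transport_duality (V : R) :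
  (forall g f, (forall i j, g i <= f j + c i j) ->
     \sum_i p i * g i - \sum_j q j * f j <= V) ->
  exists x : I * J -> R, [/\ forall t, 0 <= x t,
    forall i, \sum_j x (i, j) = p i, forall j, \sum_i x (i, j) = q j &
    \sum_i \sum_j x (i, j) * c i j <= V].
Proof.
move=> dualV.
have V0 : 0 <= V.
  have := dualV (fun=> 0) (fun=> 0); rewrite !big1 ?subrr; first last.
  - by move=> *; rewrite mulr0.
  - by move=> *; rewrite mulr0.
  by apply => i j; rewrite add0r.
(* The first two terms are twice the positive part of [cost x - V], so [G x = 0] says that [x] is an
   exact plan of cost at most [V]. Penalised plans with large [k] make [G] arbitrarily small, and
   compactness yields a zero. *)
pose G x := `|cost x - V| + (cost x - V) + defect x.
have cG : continuous (G : W -> R).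
  have cV : continuous (fun z : W => cost z - V).
    by apply: add_cont; [exact: cost_cont|exact: cst_cont].
  apply: add_cont; last exact: defect_cont.
  apply: add_cont => // z.
  apply: (@continuous_comp W R R (fun z => cost z - V) (fun r : R => `|r|) z (cV z)).
  exact: norm_continuous.
have [x xM xmin] := box_argmin (le_trans ler01 M_ge1) cG.
have Gx : G x <= 0.
  apply/ler_addgt0Pr => e e0; rewrite add0r.
  have k0 : 0 < (V + 1) / e by rewrite divr_gt0// ltr_wpDl.
  have [y yM [cy dy]] := penalised dualV k0.
  apply: le_trans (xmin y yM) _; rewrite /G ler0_norm ?subr_le0// addNr add0r.
  have : (V + 1) / e * defect y <= V + 1 by rewrite (le_trans dy)// lerDl.
  by rewrite mulrAC ler_pdivrMr// ler_pM2l// ltr_wpDl.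
have x0 t : 0 <= x t by case/andP: (xM t).
have m0 := normr_ge0 (cost x - V).
have d0 := defect_ge0 x.
have cx : cost x <= V.
  have := ler_norm (cost x - V); move: Gx; rewrite /G; lra.
have dx : defect x = 0 by move: Gx; have := ler_norm (- (cost x - V)); rewrite normrN /G; lra.
move/eqP: dx; rewrite paddr_eq0 ?sumr_ge0//; try by move=> *; exact: sqr_ge0.
rewrite !psumr_eq0; try by move=> *; exact: sqr_ge0.
move=> /andP[/allP rx /allP qx]; exists x; split => //.
- by move=> i; apply/eqP; rewrite -subr_eq0 -sqrf_eq0; exact: rx.
- by move=> j; apply/eqP; rewrite -subr_eq0 -sqrf_eq0; exact: qx.
Qed.

End finite_transport.

(** * Quantisation and gluing *)

Section finite_partition.
Context d (T : measurableType d) (R : realType) (P : probability T R).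
Context (I : finType) (a : T -> I).
Hypothesis ma : forall i, measurable (a @^-1` [set i]).

Lemma measure_cells S : measurable S ->
  P S = (\sum_i P (S `&` a @^-1` [set i]))%E.
Proof.
move=> mS.
pose F (k : 'I_#|I|) := S `&` a @^-1` [set enum_val k].
have SF : S = \big[setU/set0]_(k < #|I|) F k.
  rewrite -bigcup_pred; apply/seteqP; split => [x Sx|x [k _ []//]].
  by exists (enum_rank (a x)) => //; split=> //=; rewrite enum_rankK.
rewrite [in LHS]SF [LHS]measure_bigsetU_ord.
- rewrite -(big_enum_val (fun i => P (S `&` a @^-1` [set i]))); exact: eq_bigr.
- by move=> k; exact: measurableI.
- apply/trivIsetP => k l _ _ kl; rewrite -subset0 => x [[_ /= h1] [_ /= h2]].
  by move/negP: kl; apply; apply/eqP/enum_val_inj; rewrite -h1.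
Qed.

Let decompose (u : I -> R) x :
  (u (a x))%:E = (\sum_i (u i * \1_(a @^-1` [set i]) x)%:E)%E.
Proof.
rewrite sumEFin; congr EFin; rewrite (bigD1 (a x))//= indicE mem_set// mulr1 big1 ?addr0//.
by move=> i ia; rewrite indicE memNset ?mulr0// => /= h; rewrite h eqxx in ia.
Qed.

Let term_integrable (u : I -> R) i :
  P.-integrable setT (fun x => (u i * \1_(a @^-1` [set i]) x)%:E).
Proof. by apply: integrable_scaler; exact: integrable_indic. Qed.

Lemma integrable_finite_valued (u : I -> R) :
  P.-integrable setT (EFin \o (fun x => u (a x))).
Proof.
rewrite (_ : _ \o _ = fun x => (\sum_i (u i * \1_(a @^-1` [set i]) x)%:E)%E).
  by apply: integrable_sum.
by apply/funext => x; exact: decompose.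
Qed.

Lemma Rintegral_finite_valued (u : I -> R) :
  \int[P]_x u (a x) = \sum_i u i * fine (P (a @^-1` [set i])).
Proof.
apply: EFin_inj; rewrite EFin_Rintegral; last exact: integrable_finite_valued.
under eq_integral do rewrite decompose.
rewrite integral_sum// -sumEFin; apply: eq_bigr => i _.
under eq_integral do rewrite EFinM.
rewrite integralZl//; last exact: integrable_indic.
by rewrite integral_indic// setIT EFinM fineK// fin_num_measure.
Qed.

End finite_partition.

(** * A coupling built from a transport plan between cells *)

Section gluing.
Context d1 d2 (T1 : measurableType d1) (T2 : measurableType d2) (R : realType).
Context (nu : probability T1 R) (mu : probability T2 R).
Context (I J : finType) (a : T1 -> I) (b : T2 -> J).
Hypothesis ma : forall i, measurable (a @^-1` [set i]).
Hypothesis mb : forall j, measurable (b @^-1` [set j]).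
Context (x : I * J -> R) (t0 : I * J).

Let p i := fine (nu (a @^-1` [set i])).
Let q j := fine (mu (b @^-1` [set j])).
Let cell (t : I * J) := (a @^-1` [set t.1]) `*` (b @^-1` [set t.2]).

Hypothesis x_ge0 : forall t, 0 <= x t.
Hypothesis x_row : forall i, \sum_j x (i, j) = p i.
Hypothesis x_col : forall j, \sum_i x (i, j) = q j.

Let mcell t : measurable (cell t).
Proof. exact: measurableX. Qed.

Let w_ge0 t : 0 <= x t / (p t.1 * q t.2).
Proof. by rewrite divr_ge0// mulr_ge0// fine_ge0. Qed.

(** On each product of cells the coupling is [nu \x mu] rescaled to mass [x t], so that the
    coordinates are independent given their cells. [t0] is the default of [nth]. *)
Let part k : {measure set (T1 * T2) -> \bar R} :=
  let t := nth t0 (enum {: I * J}) k in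
  mscale (NngNum (w_ge0 t)) (mrestr (nu \x mu)%E (mcell t)).

Definition glue := msum part #|{: I * J}|.

HB.instance Definition _ := Measure.on glue.

Let glueE S : glue S =
  (\sum_t (x t / (p t.1 * q t.2))%:E * (nu \x mu) (S `&` cell t))%E.
Proof.
rewrite /glue /msum /= -[RHS]big_enum/= (big_nth t0) big_mkord -cardE.
by apply: eq_bigr => k _.
Qed.

Let al A i := fine (nu (A `&` a @^-1` [set i])).
Let be B j := fine (mu (B `&` b @^-1` [set j])).

Let alE A i : measurable A -> nu (A `&` a @^-1` [set i]) = (al A i)%:E.
Proof. by move=> mA; rewrite fineK// fin_num_measure//; exact: measurableI. Qed.

Let beE B j : measurable B -> mu (B `&` b @^-1` [set j]) = (be B j)%:E.
Proof. by move=> mB; rewrite fineK// fin_num_measure//; exact: measurableI. Qed.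

Let glueX A B : measurable A -> measurable B -> glue (A `*` B) =
  (\sum_i \sum_j x (i, j) / (p i * q j) * (al A i * be B j))%:E.
Proof.
move=> mA mB; rewrite glueE pair_bigA/= -sumEFin; apply: eq_bigr => -[i j] _ /=.
have -> : (A `*` B) `&` cell (i, j) = (A `&` a @^-1` [set i]) `*` (B `&` b @^-1` [set j]).
  by rewrite setXI.
rewrite product_measure1E; try exact: measurableI.
by rewrite !EFinM; congr (_ * (_ * _))%E; [exact: alE|exact: beE].
Qed.

Let al_le A i : measurable A -> 0 <= al A i <= p i.
Proof.
move=> mA; rewrite fine_ge0//= fine_le ?fin_num_measure//; first exact: measurableI.
by apply: le_measure; rewrite ?inE//; exact: measurableI.
Qed.

Let be_le B j : measurable B -> 0 <= be B j <= q j.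
Proof.
move=> mB; rewrite fine_ge0//= fine_le ?fin_num_measure//; first exact: measurableI.
by apply: le_measure; rewrite ?inE//; exact: measurableI.
Qed.

Let x_le_row i j : x (i, j) <= p i.
Proof. by rewrite -x_row (bigD1 j)//= lerDl sumr_ge0. Qed.

Let x_le_col i j : x (i, j) <= q j.
Proof. by rewrite -x_col (bigD1 i)//= lerDl sumr_ge0. Qed.

(** If a cell is null the quotient is zero by convention; this is consistent, because [x (i, j)] is
    at most [p i] and at most [q j] and so vanishes too. *)
Let wK i j : x (i, j) / (p i * q j) * (p i * q j) = x (i, j).
Proof.
case: (eqVneq (p i * q j) 0) => [pq|pq]; last by rewrite divfK.
rewrite pq mulr0; apply/esym/eqP; rewrite eq_le x_ge0 andbT.
by move/eqP: pq; rewrite mulf_eq0 => /orP[]/eqP <-.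
Qed.

Let divK u v : 0 <= u <= v -> u / v * v = u :> R.
Proof.
case: (eqVneq v 0) => [->|v0 _]; last by rewrite divfK.
by rewrite mulr0 => /le_anti.
Qed.

Let beT j : be setT j = q j. Proof. by rewrite /be setTI. Qed.
Let alT i : al setT i = p i. Proof. by rewrite /al setTI. Qed.

Lemma glue_fst A : measurable A -> glue (A `*` setT) = nu A.
Proof.
move=> mA; rewrite glueX// (measure_cells nu ma mA).
under [RHS]eq_bigr do rewrite (alE _ mA).
rewrite sumEFin; congr EFin; apply: eq_bigr => i _.
transitivity (al A i / p i * \sum_j x (i, j)); last by rewrite x_row (divK (al_le i mA)).
rewrite mulr_sumr; apply: eq_bigr => j _.
by rewrite beT -[in LHS](divK (al_le i mA)) -[in RHS]wK; ring.
Qed.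

Lemma glue_snd B : measurable B -> glue (setT `*` B) = mu B.
Proof.
move=> mB; rewrite glueX// (measure_cells mu mb mB).
under [RHS]eq_bigr do rewrite (beE _ mB).
rewrite sumEFin exchange_big/=; congr EFin; apply: eq_bigr => j _.
transitivity (be B j / q j * \sum_i x (i, j)); last by rewrite x_col (divK (be_le j mB)).
rewrite mulr_sumr; apply: eq_bigr => i _.
by rewrite alT -[in LHS](divK (be_le j mB)) -[in RHS]wK; ring.
Qed.

Lemma glue_cell t : glue (cell t) = (x t)%:E.
Proof.
case: t => i j; rewrite glueX//; congr EFin.
have cap (T : Type) (K : eqType) (f : T -> K) k k' : k' != k ->
    f @^-1` [set k] `&` f @^-1` [set k'] = set0.
  by move=> kk'; rewrite -subset0 => z [/= h1 h2]; rewrite -h2 h1 eqxx in kk'.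
rewrite (bigD1 i)//= [X in _ + X]big1 ?addr0; last first.
  move=> i' i'i; rewrite big1// => j' _.
  by rewrite /al cap// measure0 mul0r mulr0.
rewrite (bigD1 j)//= [X in _ + X]big1 ?addr0; last first.
  by move=> j' j'j; rewrite /be cap// measure0 !mulr0.
by rewrite /al /be !setIid; exact: wK.
Qed.

Let glue_setT : glue setT = 1%E.
Proof. by rewrite -setXTT glue_fst// probability_setT. Qed.

HB.instance Definition _ := Measure_isProbability.Build _ _ _ glue glue_setT.

Lemma exists_gluing : exists pi : probability (T1 * T2)%type R,
  [/\ forall A, measurable A -> pi (A `*` setT) = nu A,
      forall B, measurable B -> pi (setT `*` B) = mu B &
      forall t, pi (cell t) = (x t)%:E].
Proof. by exists glue; split; [exact: glue_fst|exact: glue_snd|exact: glue_cell]. Qed.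

End gluing.

(** * Nearest-point quantisation and its mean error *)

Section nearest_point.
Context {R : realType} {X : pointedType} (rho : X -> X -> R).
Hypothesis rho_metric : is_metric rho.

(** Starting at [x0], the point with a finite second moment, makes [rho x0 x ^ 2] dominate every
    quantisation error. *)
Lemma dense_sequence x0 : rho_separable rho ->
  exists2 c : nat -> X, c 0 = x0 & forall x e, 0 < e -> exists n, rho (c n) x < e.
Proof.
case=> D [/countable_injP[f finj] dense].
pose c n := if n is m.+1 then xget x0 [set y | D y /\ f y = m] else x0.
exists c => // x e e0; have [y Dy xy] := dense x e e0.
exists (f y).+1; have [] := @xgetI _ x0 [set z | D z /\ f z = f y] y (conj Dy erefl).
case: rho_metric => _ _ rhoC _; rewrite rhoC.
by move=> Dz /finj /= ->//; rewrite inE.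
Qed.

Variable c : nat -> X.

(** The strict comparison gives ties to the smaller index, and the recursion allows measurability to
    be proved by induction on [N]. *)
Fixpoint nearest (N : nat) (x : X) : nat :=
  if N is N'.+1 then
    if rho (c N) x < rho (c (nearest N' x)) x then N else nearest N' x
  else 0.

Lemma nearest_le N x : (nearest N x <= N)%N.
Proof. by elim: N => //= N IH; case: ifP => // _; exact: leqW. Qed.

Lemma nearest_dist_le N n x : (n <= N)%N ->
  rho (c (nearest N x)) x <= rho (c n) x.
Proof.
elim: N => [|N IH]; first by rewrite leqn0 => /eqP ->.
rewrite leq_eqVlt => /predU1P[->|]; rewrite /=.
  by case: ifPn => //; rewrite -leNgt.
by rewrite ltnS => /IH h; case: ifPn => // /ltW /le_trans; apply.
Qed.

(** The choice of the next index compares distances, so the distance and the index are treated in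
    one induction. *)
Let nearest_measurable N :
  measurable_fun setT ((fun x => rho (c (nearest N x)) x) : borel rho -> R) /\
  measurable_fun setT (nearest N : borel rho -> nat).
Proof.
elim: N => [|N [IH1 IH2]]; first by split; [exact: (dist_borel_measurable rho_metric (c 0))|exact: measurable_cst].
have md n := dist_borel_measurable rho_metric (c n).
have mlt := measurable_fun_ltr (md N.+1) IH1.
split; last exact: measurable_fun_ifT.
have := measurable_fun_ifT mlt (md N.+1) IH1.
by congr measurable_fun; apply/funext => x /=; case: ifP.
Qed.

Definition quantisation_error N x : R := rho (c (nearest N x)) x ^+ 2.

Lemma quantisation_error_measurable N :
  measurable_fun setT (quantisation_error N : borel rho -> R).
Proof. by apply: measurable_funX; case: (nearest_measurable N). Qed.

Lemma quantisation_error_ge0 N x : 0 <= quantisation_error N x.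
Proof. exact: sqr_ge0. Qed.

Lemma nearest_level_measurable N (i : 'I_N.+1) :
  measurable ((fun x => inord (nearest N x)) @^-1` [set i] : set (borel rho)).
Proof.
have [_ mn] := nearest_measurable N.
rewrite (_ : _ @^-1` _ = setT `&` (nearest N : borel rho -> nat) @^-1` [set (i : nat)]).
  exact: mn.
rewrite setTI; apply/seteqP; split => x /=.
  by move=> <-; rewrite inordK// ltnS nearest_le.
by move=> ->; rewrite inord_val.
Qed.

Hypothesis c_dense : forall x e, 0 < e -> exists n, rho (c n) x < e.

Lemma quantisation_error_cvg0 x : quantisation_error ^~ x @ \oo --> (0 : R).
Proof.
have rho0 y z : 0 <= rho y z by case: rho_metric.
apply/cvgrPdist_lt => e e0.
(* A distance below both [1] and [e] has its square below [e]. *)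
have [n ne] := @c_dense x (Num.min 1 e) ltac:(by rewrite lt_min ltr01).
near=> N; rewrite sub0r normrN ger0_norm ?sqr_ge0//.
have h : rho (c (nearest N x)) x < Num.min 1 e.
  by apply: le_lt_trans ne; apply: nearest_dist_le; near: N; exact: nbhs_infty_ge.
move: h; rewrite lt_min => /andP[h1 h2]; apply: le_lt_trans h2.
by rewrite /quantisation_error expr2 ler_piMl// ltW.
Unshelve. all: by end_near. Qed.

Context (P : probability (borel rho) R).
Hypothesis P_moment : (\int[P]_x ((rho (c 0) x) ^+ 2)%:E < +oo)%E.

Let moment_integrable :
  P.-integrable setT (EFin \o (fun x : borel rho => rho (c 0) x ^+ 2)).
Proof.
apply/integrableP; split.
  by apply/measurable_EFinP; apply: measurable_funX; exact: dist_borel_measurable.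
by under eq_integral do rewrite /= ger0_norm ?sqr_ge0//.
Qed.

Let error_le N x : quantisation_error N x <= rho (c 0) x ^+ 2.
Proof.
have rho0 y z : 0 <= rho y z by case: rho_metric.
by rewrite ler_pXn2r ?nnegrE//; exact: nearest_dist_le.
Qed.

Lemma quantisation_error_integrable N :
  P.-integrable setT (EFin \o (quantisation_error N : borel rho -> R)).
Proof.
apply: le_integrable moment_integrable => //.
  apply/measurable_EFinP; exact: quantisation_error_measurable.
by move=> x _ /=; rewrite lee_fin !ger0_norm ?sqr_ge0.
Qed.

Lemma mean_quantisation_error_cvg0 :
  \int[P]_x quantisation_error N x @[N --> \oo] --> (0 : R).
Proof.
have : (\int[P]_x (quantisation_error N x)%:E)%E @[N --> \oo] --> (0 : R)%:E.
  rewrite [X in _ --> X](_ : _ = \int[P]_(x in setT) (cst 0%E x))%E; last first.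
    by rewrite integral_cst// mul0e.
  apply: (@dominated_cvg _ _ _ P setT measurableT _ _
            (EFin \o (fun x : borel rho => rho (c 0) x ^+ 2))) => //.
  - by move=> N; apply/measurable_EFinP; exact: quantisation_error_measurable.
  - by move=> x _; apply: cvg_EFin; [exact: nearW|exact: quantisation_error_cvg0].
  - by move=> N x _ /=; rewrite lee_fin ger0_norm ?sqr_ge0.
exact: fine_cvg.
Qed.

End nearest_point.

(** Young's inequality with weight [d] keeps the constant of the main term close to one and charges
    the rest to the two quantisation errors. *)
Lemma sqr_add_le (R : realFieldType) (d u v r s : R) : 0 < d -> 0 <= u -> 0 <= v ->
  0 <= r -> 0 <= s -> u <= v + (r + s) ->
  u ^+ 2 <= (1 + d) * v ^+ 2 + 2 * (1 + d^-1) * (r ^+ 2 + s ^+ 2).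
Proof.
move=> d0 u0 v0 r0 s0 h.
have h1 : u ^+ 2 <= (v + (r + s)) ^+ 2 by rewrite ler_pXn2r ?nnegrE ?addr_ge0.
have di : 0 < d^-1 by rewrite invr_gt0.
have e1 : (v + (r + s)) ^+ 2 = (1 + d) * v ^+ 2 + (1 + d^-1) * (r + s) ^+ 2
    - d * (v - d^-1 * (r + s)) ^+ 2 by field; rewrite gt_eqF.
have h2 : 0 <= d * (v - d^-1 * (r + s)) ^+ 2 by rewrite mulr_ge0 ?sqr_ge0// ltW.
have h3 : (1 + d^-1) * (r + s) ^+ 2 <= (1 + d^-1) * (2 * (r ^+ 2 + s ^+ 2)).
  by rewrite ler_pM2l ?addr_gt0//; have := sqr_ge0 (r - s); rewrite sqrrB sqrrD; lra.
rewrite -[2 * _ * _]mulrA [2 * ((1 + _) * _)]mulrCA; lra.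
Qed.

(** * From the dual bound to couplings of nearly optimal cost *)

Section transport_cost_bound.
Context {R : realType} {X : pointedType} (rho : X -> X -> R).
Hypothesis rho_metric : is_metric rho.
Context (mu nu : probability (borel rho) R) (C H : R).

(* The Kantorovich dual form of the bound [W2cost nu mu <= C * H]. *)
Hypothesis dual_bound : forall (f g : X -> R) (B : R),
  measurable_fun setT (f : borel rho -> R) -> (forall y, `|f y| <= B) ->
  nu.-integrable setT (EFin \o (g : borel rho -> R)) ->
  (forall x y, g x <= f y + rho x y ^+ 2) ->
  \int[nu]_x g x <= \int[mu]_x f x + C * H.

Context (c : nat -> X).
Hypothesis nu_moment : (\int[nu]_x ((rho (c 0) x) ^+ 2)%:E < +oo)%E.
Hypothesis mu_moment : (\int[mu]_x ((rho (c 0) x) ^+ 2)%:E < +oo)%E.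

Let rho_ge0 x y : 0 <= rho x y. Proof. by case: rho_metric. Qed.
Let rhoC x y : rho x y = rho y x. Proof. by case: rho_metric. Qed.
Let rho_triangle x y z : rho x z <= rho x y + rho y z. Proof. by case: rho_metric. Qed.

Let sum_norm_ge (T : finType) (u : T -> R) t : `|u t| <= \sum_t `|u t|.
Proof. by rewrite [leRHS](bigD1 t)//= lerDl sumr_ge0. Qed.

Context (N : nat) (d : R).
Hypothesis d_gt0 : 0 < d.

Let e2 := quantisation_error rho c N.
Let cell (x : borel rho) : 'I_N.+1 := inord (nearest rho c N x).
Let z (i : 'I_N.+1) := c i.
Let cost i j := rho (z i) (z j) ^+ 2.
Let K := 2 * (1 + d^-1).
Let E := \int[nu]_x e2 x + \int[mu]_x e2 x.
Let p i := fine (nu (cell @^-1` [set i])).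
Let q i := fine (mu (cell @^-1` [set i])).

Let K_ge0 : 0 <= K. Proof. by rewrite mulr_ge0// addr_ge0// invr_ge0 ltW. Qed.
Let d1_gt0 : 0 < 1 + d. Proof. by rewrite addr_gt0. Qed.

Let z_cell x : z (cell x) = c (nearest rho c N x).
Proof. by rewrite /z /cell inordK// ltnS nearest_le. Qed.

Let cost_le x y : cost (cell x) (cell y) <= (1 + d) * rho x y ^+ 2 + K * (e2 x + e2 y).
Proof.
rewrite /cost !z_cell; apply: sqr_add_le => //.
have h1 := rho_triangle (c (nearest rho c N x)) x (c (nearest rho c N y)).
have h2 := rho_triangle x y (c (nearest rho c N y)).
rewrite (rhoC y (c _)) in h2; lra.
Qed.

Let rho_le x y : rho x y ^+ 2 <= (1 + d) * cost (cell x) (cell y) + K * (e2 x + e2 y).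
Proof.
rewrite /cost !z_cell; apply: sqr_add_le => //.
have h1 := rho_triangle x (c (nearest rho c N x)) y.
have h2 := rho_triangle (c (nearest rho c N x)) (c (nearest rho c N y)) y.
rewrite (rhoC x (c _)) in h1; lra.
Qed.

Let mcell i : measurable (cell @^-1` [set i]).
Proof. exact: nearest_level_measurable. Qed.

Let nu_e2 := quantisation_error_integrable rho_metric nu_moment N.
Let mu_e2 := quantisation_error_integrable rho_metric mu_moment N.

(** A dual pair on the centres is pulled back to the space through [cell], divided by [1 + d] and
    corrected by the quantisation errors; [cost_le] makes it admissible for [dual_bound]. *)
Let finite_dual (g f : 'I_N.+1 -> R) : (forall i j, g i <= f j + cost i j) ->
  \sum_i p i * g i - \sum_j q j * f j <= (1 + d) * (C * H) + K * E.
Proof.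
move=> gf.
pose D := (1 + d)^-1.
have D0 : 0 < D by rewrite invr_gt0.
have D1 : D <= 1 by rewrite invf_le1// lerDl ltW.
pose k := \sum_i `|g i|.
pose G (x : borel rho) := D * g (cell x) + (- (D * K)) * e2 x.
pose F0 (y : borel rho) := D * f (cell y) + D * K * e2 y.
(* [F0] contains the possibly unbounded error [e2], while [dual_bound] asks for a bounded function;
   since [G <= k], the truncation preserves admissibility. *)
pose F (y : borel rho) := Num.min (F0 y) k.
have k0 : 0 <= k by rewrite sumr_ge0.
have iF0 : mu.-integrable setT (EFin \o F0).
  apply: integrable_addr; apply: integrable_scaler => //.
  exact: (integrable_finite_valued mu mcell f).
have mF0 : measurable_fun setT F0.
  by have /integrableP[/measurable_EFinP] := iF0.
have mF : measurable_fun setT F by exact: measurable_minr.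
have FB y : `|F y| <= \sum_i `|f i| + k.
  have f0 : 0 <= \sum_i `|f i| by rewrite sumr_ge0.
  have lo : - \sum_i `|f i| <= F0 y.
    have h1 : - \sum_i `|f i| <= D * f (cell y).
      rewrite lerNl -mulrN; apply: le_trans (sum_norm_ge f (cell y)).
      apply: le_trans (_ : D * `|f (cell y)| <= _).
        by rewrite ler_pM2l// -normrN ler_norm.
      by rewrite ler_piMl.
    apply: le_trans h1 _; rewrite lerDl.
    exact: mulr_ge0 (mulr_ge0 (ltW D0) K_ge0) (quantisation_error_ge0 rho c N y).
  rewrite ler_norml /F le_min ge_min; apply/andP; split; last first.
    by apply/orP; right; rewrite lerDr.
  apply/andP; split; last by rewrite lerNl; apply: le_trans (_ : 0 <= _); rewrite ?oppr_le0 ?addr_ge0.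
  by apply: le_trans lo; rewrite lerN2 lerDl.
have iG : nu.-integrable setT (EFin \o G).
  apply: integrable_addr; apply: integrable_scaler => //.
  exact: (integrable_finite_valued nu mcell g).
have GF x y : G x <= F y + rho x y ^+ 2.
  have e0 : 0 <= e2 x := quantisation_error_ge0 rho c N x.
  rewrite /F; case: (leP (F0 y) k) => _.
    have h := le_trans (gf (cell x) (cell y)) (_ : _ <= f (cell y) + ((1 + d) * rho x y ^+ 2 + K * (e2 x + e2 y))).
    have {}h : D * g (cell x) <= D * (f (cell y) + ((1 + d) * rho x y ^+ 2 + K * (e2 x + e2 y))).
      by rewrite ler_pM2l//; apply: h; rewrite lerD2l.
    have De : D * ((1 + d) * rho x y ^+ 2) = rho x y ^+ 2 by rewrite mulKf// gt_eqF.
    rewrite /G /F0; move: h; rewrite !mulrDr De; lra.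
  apply: (@le_trans _ _ k); last by rewrite lerDl sqr_ge0.
  apply: (@le_trans _ _ (D * g (cell x))).
    by rewrite gerDl mulNr oppr_le0; exact: mulr_ge0 (mulr_ge0 (ltW D0) K_ge0) e0.
  apply: le_trans (sum_norm_ge g (cell x)).
  apply: le_trans (_ : D * `|g (cell x)| <= _); first by rewrite ler_pM2l// ler_norm.
  by rewrite ler_piMl.
have main := dual_bound mF FB iG GF.
have FF0 : \int[mu]_x F x <= \int[mu]_x F0 x.
  apply: le_Rintegral => //; first exact: (@bounded_integrable _ _ _ mu _ (\sum_i `|f i| + k)).
  by move=> x _; rewrite ge_min lexx.
have IG : \int[nu]_x G x = D * \sum_i p i * g i - D * K * \int[nu]_x e2 x.
  rewrite Rintegral_lincomb//; last exact: (integrable_finite_valued nu mcell g).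
  rewrite (Rintegral_finite_valued nu mcell g) mulNr; congr (_ * _ - _).
  by apply: eq_bigr => i _; rewrite mulrC.
have IF : \int[mu]_x F0 x = D * \sum_j q j * f j + D * K * \int[mu]_x e2 x.
  rewrite Rintegral_lincomb//; last exact: (integrable_finite_valued mu mcell f).
  rewrite (Rintegral_finite_valued mu mcell f); congr (_ * _ + _).
  by apply: eq_bigr => i _; rewrite mulrC.
rewrite /E; move: main FF0; rewrite IG IF.
move: (\int[nu]_x e2 x) (\int[mu]_x e2 x) (\int[mu]_x F x) (\sum_i p i * g i)
  (\sum_j q j * f j) (C * H) => b r a s t u h1 h2.
have h3 : (1 + d) * (D * s - D * K * b) <= (1 + d) * (D * t + D * K * r + u).
  by rewrite ler_pM2l//; lra.
have dD : (1 + d) * D = 1 by rewrite divff// gt_eqF.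
have e1 : (1 + d) * (D * s - D * K * b) = (1 + d) * D * (s - K * b) by ring.
have e3 : (1 + d) * (D * t + D * K * r + u) = (1 + d) * D * (t + K * r) + (1 + d) * u.
  by ring.
by rewrite e1 e3 dD !mul1r in h3; lra.
Qed.

Let marginal_integral (pi : probability (borel rho * borel rho)%type R)
    (P : probability (borel rho) R) (pr : borel rho * borel rho -> borel rho)
    (h : borel rho -> R) :
  measurable_fun setT pr -> (forall A, measurable A -> pi (pr @^-1` A) = P A) ->
  (forall x, 0 <= h x) -> P.-integrable setT (EFin \o h) ->
  pi.-integrable setT (EFin \o (h \o pr)) /\ \int[pi]_x h (pr x) = \int[P]_x h x.
Proof.
move=> mpr piP h0 hi.
have mh : measurable_fun setT h by have /integrableP[/measurable_EFinP] := hi.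
have eq : (\int[pi]_x (h (pr x))%:E = \int[P]_x (h x)%:E)%E.
  rewrite -[LHS](@ge0_integral_pushforward _ _ _ _ _ pr mpr pi setT (EFin \o h))//.
  - by apply: eq_measure_integral => A mA _; exact: piP.
  - exact/measurable_EFinP.
  - by move=> y _; rewrite lee_fin.
split; last by congr fine.
apply/integrableP; split; first by apply/measurable_EFinP; exact: measurableT_comp.
under eq_integral do rewrite /= ger0_norm//.
rewrite eq; move/integrableP: hi => [_]; under eq_integral do rewrite /= ger0_norm//.
by [].
Qed.

(** An optimal plan between cells is glued to a coupling. The inner factor [1 + d] comes from
    [finite_dual], the outer one from replacing centres by points with [rho_le]. *)
Lemma W2cost_le_quantised :
  (W2cost nu mu <= ((1 + d) * ((1 + d) * (C * H) + K * E) + K * E)%:E)%E.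
Proof.
have p0 i : 0 <= p i by exact: fine_ge0.
have cost0 i j : 0 <= cost i j by exact: sqr_ge0.
have [x [x0 xp xq xV]] := finite_transport_duality p0 cost0 finite_dual.
have [pi [pi1 pi2 pix]] := exists_gluing mcell mcell (ord0, ord0) x0 xp xq.
apply: (@le_trans _ _ (\int[pi]_w ((rho w.1 w.2) ^+ 2)%:E)%E).
  by apply: ereal_inf_lbound; exists pi.
pose cc (t : 'I_N.+1 * 'I_N.+1) := cost t.1 t.2.
pose cell2 (w : borel rho * borel rho) := (cell w.1, cell w.2).
have cell2E t : cell2 @^-1` [set t] = (cell @^-1` [set t.1]) `*` (cell @^-1` [set t.2]).
  by case: t => i j; apply/seteqP; split => [w [<- <-]//|[w1 w2] [/= <- <-]].
have mcell2 t : measurable (cell2 @^-1` [set t]) by rewrite cell2E; exact: measurableX.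
have fstE A : measurable A -> pi (fst @^-1` A) = nu A.
  by move=> mA; rewrite -pi1//; congr (pi _); apply/seteqP; split => [w|w []].
have sndE A : measurable A -> pi (snd @^-1` A) = mu A.
  by move=> mA; rewrite -pi2//; congr (pi _); apply/seteqP; split => [w|w []].
have e0 := quantisation_error_ge0 rho c N.
have [i1 E1] := marginal_integral measurable_fst fstE e0 nu_e2.
have [i2 E2] := marginal_integral measurable_snd sndE e0 mu_e2.
have ic := integrable_finite_valued pi mcell2 cc.
have i12 := integrable_addr i1 i2.
pose h (w : borel rho * borel rho) := (1 + d) * cc (cell2 w) + K * (e2 w.1 + e2 w.2).
apply: (@le_trans _ _ (\int[pi]_w (h w)%:E)%E).
  by apply: ge0_le_integralT => w; rewrite lee_fin ?sqr_ge0//; exact: rho_le.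
rewrite -EFin_Rintegral; last by apply: integrable_addr; exact: integrable_scaler.
rewrite lee_fin Rintegral_lincomb//.
rewrite [X in _ + K * X]RintegralD// E1 E2 -/E lerD2r ler_pM2l//.
apply: le_trans xV; rewrite (Rintegral_finite_valued pi mcell2 cc) pair_bigA/=.
by apply: ler_sum => t _; rewrite cell2E pix/= mulrC; case: t.
Qed.

End transport_cost_bound.

Theorem theorem3p5 (R : realType) (X : pointedType) (rho : X -> X -> R)
  (Hpolish : polish rho) (mu : probability (borel rho) R) (Hmu : P2 mu)
  (C : R) (HC : 0 < C) :
  LSIplus mu C -> T2 mu C.
Proof.
move=> LSI nu; rewrite /relent; case: pselect => [nu_mu|not_dominated]; last first.
  by rewrite gt0_muley ?lte_fin// leey.
set H := (\int[nu]_x _)%E.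
case: (eqVneq H +oo%E) => [->|Hfin]; first by rewrite gt0_muley ?lte_fin// leey.
have iH := relent_integrable nu_mu ltac:(by rewrite -/H ltey).
rewrite /H -EFin_Rintegral//.
set h := \int[nu]_x _.
case: Hpolish => rho_metric _ separable.
have h0 : 0 <= h := relent_ge0 rho_metric HC LSI nu_mu iH.
case: Hmu => x0 mu_moment.
have nu_moment := second_moment_dominated rho_metric HC LSI nu_mu iH mu_moment.
have [c c0 dense] := dense_sequence rho_metric x0 separable.
rewrite -c0 in mu_moment nu_moment.
have dual := transport_dual rho_metric HC LSI nu_mu iH.
have Ch0 : 0 <= C * h by rewrite mulr_ge0// ltW.
apply/lee_addgt0Pr => e e0; rewrite -EFinM -EFinD.
(* [d] is small enough for [(1 + d) ^ 2 * C * h <= C * h + e / 2]. *)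
pose d := Num.min 1 (e / (6 * (C * h + 1))).
have d0 : 0 < d by rewrite lt_min ltr01 divr_gt0// mulr_gt0// ltr_wpDl.
have d1 : d <= 1 by rewrite ge_min lexx.
have de : d * (6 * (C * h + 1)) <= e.
  by rewrite -ler_pdivlMr ?ge_min ?lexx ?orbT// mulr_gt0// ltr_wpDl.
pose K := 2 * (1 + d^-1).
have K0 : 0 < K by rewrite mulr_gt0// addr_gt0// invr_gt0.
(* Two mean errors below [th] contribute at most [e / 6] after multiplication by [K]. *)
pose th := e / (12 * K).
have th0 : 0 < th by rewrite divr_gt0// mulr_gt0.
have cvn := mean_quantisation_error_cvg0 rho_metric dense nu_moment.
have cvm := mean_quantisation_error_cvg0 rho_metric dense mu_moment.
have [N [Nn Nm]] : exists N, \int[nu]_x quantisation_error rho c N x < th /\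
    \int[mu]_x quantisation_error rho c N x < th.
  suff /filter_ex : \forall N \near \oo, \int[nu]_x quantisation_error rho c N x < th /\
    \int[mu]_x quantisation_error rho c N x < th by [].
  near=> N; split; near: N; [exact: (cvgr_lt _ cvn)|exact: (cvgr_lt _ cvm)].
apply: le_trans (W2cost_le_quantised rho_metric dual nu_moment mu_moment N d0) _.
rewrite lee_fin -/K.
move: (\int[nu]_x _) (\int[mu]_x _) Nn Nm => A B An Bn.
have KE : K * (A + B) <= e / 6.
  apply: (@le_trans _ _ (K * (th + th))); first by rewrite ler_pM2l// lerD// ltW.
  rewrite le_eqVlt; apply/orP; left; apply/eqP; rewrite /th; field; rewrite gt_eqF//.
move: (K * (A + B)) (C * h) KE Ch0 de => E s KE s0 de.
have ds0 : 0 <= d * s by rewrite mulr_ge0// ltW.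
have dds : d * (d * s) <= d * s by rewrite ler_piMl.
have dE : d * E <= d * (e / 6) by rewrite ler_pM2l.
have de6 : d * (e / 6) <= e / 6 by rewrite ler_piMl// divr_ge0// ltW.
(* The terms in [d * s] amount to at most [3 * (e / 6)], and so do those in [E]. *)
have -> : (1 + d) * ((1 + d) * s + E) + E = s + 2 * (d * s) + d * (d * s) + 2 * E + d * E.
  by ring.
lra.
Unshelve. all: by end_near. Qed.
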